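(* Let $T\subset\mathbb R^2$ be a nondegenerate triangle, let $w_0,w_1,w_2$ be the functions given in the context, and let $U_3(T):=\mathbb P_3(T)+\operatorname{span}\{w_0,w_1,w_2\}$. Then $$U_3(T)=\bigoplus_{\mathtt v\in\Delta_0(T)}\bigl(U_{\mathtt v}^0\oplus U_{\mathtt v}^1\bigr)\oplus W^1,\qquad W^1:=\operatorname{span}\{w_0,w_1,w_2\},$$ where, for $\mathtt v=\mathtt v_i$, $U_{\mathtt v}^0=\operatorname{span}\{\lambda_i^3\}$ and $U_{\mathtt v}^1=\operatorname{span}\{\lambda_i^2\lambda_{i+1},\lambda_i^2\lambda_{i-1}\}$. In particular, $\dim U_3(T)=12$. Moreover, any $v\in U_3(T)$ is uniquely determined by the degrees of freedom $$v(\mathtt v),\quad\nabla v(\mathtt v)\quad(\mathtt v\in\Delta_0(T)),\qquad\int_e\frac{\partial v}{\partial n}\,q\,{\rm d}s\quad(q\in\mathbb P_0(e),\ e\in\Delta_1(T)).$$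
   Context: $T$ has vertices $\mathtt v_0,\mathtt v_1,\mathtt v_2$, area $|T|$ and barycenter $\mathtt v_c=(\mathtt v_0+\mathtt v_1+\mathtt v_2)/3$. The barycentric refinement splits $T$ into subtriangles $T_0,T_1,T_2$, where $T_i$ is the convex hull of $\mathtt v_c$ and the two vertices $\mathtt v_j$, $j\ne i$. $\lambda_i$ is the barycentric coordinate of $T$ associated with $\mathtt v_i$; $\lambda_i^{\rm R}$ is the continuous function on $T$, affine on each $T_j$, with $\lambda_i^{\rm R}(\mathtt v_i)=1$ and value $0$ at $\mathtt v_c$ and at the other two vertices. Indices $i\in\{0,1,2\}$ are understood modulo 3. $e_i$ is the edge opposite to $\mathtt v_i$ with a fixed unit normal $\boldsymbol n_i$, $\partial/\partial n$ on $e_i$ is the derivative in direction $\boldsymbol n_i$, $c_{i,i}=\nabla\lambda_i\cdot\boldsymbol n_i$, and $C_T=4|T|^2/9$. $\Delta_0(T)$, $\Delta_1(T)$ are the sets of vertices and edges of $T$; $\mathbb P_m$ denotes polynomials of degree at most $m$. The functions (case $k=1$ of the paper's family, all in $C^1(T)$) are $$v_{i,i+1}=\tfrac{C_T}{2}\bigl[(\lambda_i^{\rm R})^2-\lambda_i^2\bigr](\lambda_{i-1}-\lambda_{i+1})-C_T\lambda_0\lambda_1\lambda_2,\qquad v_{i,i-1}=\tfrac{C_T}{2}\bigl[(\lambda_i^{\rm R})^2-\lambda_i^2\bigr](\lambda_{i-1}-\lambda_{i+1})+C_T\lambda_0\lambda_1\lambda_2,$$ $$w_i=\frac{1}{4C_Tc_{i,i}}\bigl(v_{i+1,i}-v_{i-1,i}\bigr),\qquad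 i=0,1,2.$$ *)

(* Defs.v *)
From HB Require Import structures.
From mathcomp Require Import all_boot all_order all_algebra.
From mathcomp Require Import all_classical all_reals all_analysis.
From mathcomp Require Import ring lra.

Set Implicit Arguments.
Unset Strict Implicit.
Unset Printing Implicit Defensive.

Import Order.TTheory GRing.Theory Num.Theory.
Import numFieldNormedType.Exports.

Local Open Scope classical_set_scope.
Local Open Scope ring_scope.

Definition lspan (R : realType) (V : lmodType R) (s : seq V) : set V :=
  [set u | exists c : 'I_(size s) -> R, u = \sum_(k < size s) c k *: s`_k].

Definition lin_indep (R : realType) (V : lmodType R) (s : seq V) : Prop :=
  forall c : 'I_(size s) -> R,
    \sum_(k < size s) c k *: s`_k = 0 -> forall k, c k = 0.

Definition has_dim (R : realType) (V : lmodType R) (n : nat) (U : set V) : Prop :=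
  exists s : seq V, [/\ size s = n, lin_indep s & lspan s = U].

Definition sum2 (R : realType) (V : lmodType R) (U W : set V) : set V :=
  [set u + w | u in U & w in W].

Definition sumI (R : realType) (V : lmodType R) (n : nat) (U : 'I_n -> set V) :
    set V :=
  [set s | exists2 u : 'I_n -> V, (forall i, U i (u i)) & s = \sum_(i < n) u i].

Definition direct2 (R : realType) (V : lmodType R) (U W : set V) : Prop :=
  forall u w, U u -> W w -> u + w = 0 -> u = 0 /\ w = 0.

Definition directI (R : realType) (V : lmodType R) (n : nat)
    (U : 'I_n -> set V) : Prop :=
  forall u : 'I_n -> V, (forall i, U i (u i)) -> \sum_(i < n) u i = 0 ->
    forall i, u i = 0.

Definition dot (R : realType) (x y : 'rV[R]_2) : R := \sum_(k < 2) x 0 k * y 0 k.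

(* 'rV[R]_2 carries the sup norm; lengths and unit vectors are Euclidean. *)
Definition enorm (R : realType) (x : 'rV[R]_2) : R := Num.sqrt (dot x x).

Definition hull (R : realType) (n : nat) (p : 'I_n -> 'rV[R]_2) : set 'rV[R]_2 :=
  [set x | exists t : 'I_n -> R,
    [/\ forall i, 0 <= t i, \sum_(i < n) t i = 1 & x = \sum_(i < n) t i *: p i]].

Definition segpt (R : realType) (a b : 'rV[R]_2) (t : R) : 'rV[R]_2 :=
  (1 - t) *: a + t *: b.

Definition segment (R : realType) (a b : 'rV[R]_2) : set 'rV[R]_2 :=
  [set segpt a b t | t in `[0, 1]].

Definition line_integral (R : realType) (a b : 'rV[R]_2) (f : 'rV[R]_2 -> R) : R :=
  enorm (b - a) * \int[@lebesgue_measure R]_(t in `[0, 1]) f (segpt a b t).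

Definition polyfun (R : realType) (m : nat) (c : nat -> nat -> R)
    (x : 'rV[R]_2) : R :=
  \sum_(a < m.+1) \sum_(b < m.+1 | (a + b <= m)%N)
    c a b * x 0 0 ^+ a * x 0 1 ^+ b.

Definition Poly (R : realType) (m : nat) (A : set 'rV[R]_2) : set (A -> R^o) :=
  [set f | exists c : nat -> nat -> R, f = sigL A (polyfun m c)].
Arguments Poly {R} m A.

(* Differentiability relative to A, so that it makes sense at boundary points
   of A; only the values of f on A matter. *)
Definition is_grad (R : realType) (A : set 'rV[R]_2) (f : 'rV[R]_2 -> R)
    (x g : 'rV[R]_2) : Prop :=
  forall e : R, 0 < e ->
    \forall y \near within A (nbhs x),
      `|f y - f x - dot g (y - x)| <= e * enorm (y - x).

(* The junk value 0 is only taken where f has no gradient relative to A. *)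
Definition grad (R : realType) (A : set 'rV[R]_2) (f : 'rV[R]_2 -> R)
    (x : 'rV[R]_2) : 'rV[R]_2 :=
  xget 0 [set g | is_grad A f x g].

Definition C1 (R : realType) (A : set 'rV[R]_2) (f : 'rV[R]_2 -> R) : Prop :=
  (forall x, A x -> is_grad A f x (grad A f x)) /\
  {within A, continuous (grad A f)}.

(* A triangle is given by its vertices v : 'I_3 -> 'rV[R]_2; 'I_3 is the ring
   Z/3Z, so that i + 1 and i - 1 below are taken modulo 3. *)

(* twice the signed area of the triangle abc *)
Definition cross (R : realType) (a b c : 'rV[R]_2) : R :=
  (b 0 0 - a 0 0) * (c 0 1 - a 0 1) - (b 0 1 - a 0 1) * (c 0 0 - a 0 0).

Definition area (R : realType) (v : 'I_3 -> 'rV[R]_2) : R :=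
  `|cross (v 0) (v 1) (v (- 1))| / 2.

Definition nondegenerate_tri (R : realType) (v : 'I_3 -> 'rV[R]_2) : Prop :=
  cross (v 0) (v 1) (v (- 1)) != 0.

Definition tri (R : realType) (v : 'I_3 -> 'rV[R]_2) : set 'rV[R]_2 := hull v.

Definition barycenter (R : realType) (v : 'I_3 -> 'rV[R]_2) : 'rV[R]_2 :=
  3^-1 *: (v 0 + v 1 + v (- 1)).

Definition subtri (R : realType) (v : 'I_3 -> 'rV[R]_2) (i : 'I_3) :
    set 'rV[R]_2 :=
  hull (fun j : 'I_3 => if j == i then barycenter v else v j).

Definition edge (R : realType) (v : 'I_3 -> 'rV[R]_2) (i : 'I_3) :
    set 'rV[R]_2 :=
  segment (v (i + 1)) (v (i - 1)).

Definition unit_normal (R : realType) (v : 'I_3 -> 'rV[R]_2) (i : 'I_3)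
    (n : 'rV[R]_2) : Prop :=
  enorm n = 1 /\ dot n (v (i - 1) - v (i + 1)) = 0.

(* Barycentric coordinates as ratios of signed areas; see baryP. *)
Definition bary (R : realType) (v : 'I_3 -> 'rV[R]_2) (i : 'I_3)
    (x : 'rV[R]_2) : R :=
  cross x (v (i + 1)) (v (i - 1)) / cross (v i) (v (i + 1)) (v (i - 1)).

(* The conditions characterizing lambda_i^R on the triangle; they can be met,
   see refined_hat_exists. *)
Definition refined_hat (R : realType) (v : 'I_3 -> 'rV[R]_2) (i : 'I_3)
    (f : 'rV[R]_2 -> R) : Prop :=
  [/\ {within tri v, continuous f},
      forall j, exists a b, forall x, subtri v j x -> f x = dot a x + b,
      f (v i) = 1,
      f (barycenter v) = 0
    & forall j, j != i -> f (v j) = 0].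

Definition CT (R : realType) (v : 'I_3 -> 'rV[R]_2) : R := 4 * area v ^+ 2 / 9.

(* bary v i is affine: its gradient does not depend on the base point v i. *)
Definition cnormal (R : realType) (v n : 'I_3 -> 'rV[R]_2) (i : 'I_3) : R :=
  dot (grad [set: 'rV[R]_2] (bary v i) (v i)) (n i).

(* v_{i,i+1} *)
Definition vnext (R : realType) (v : 'I_3 -> 'rV[R]_2)
    (lamR : 'I_3 -> 'rV[R]_2 -> R) (i : 'I_3) (x : 'rV[R]_2) : R :=
  CT v / 2 * (lamR i x ^+ 2 - bary v i x ^+ 2)
    * (bary v (i - 1) x - bary v (i + 1) x)
  - CT v * bary v 0 x * bary v 1 x * bary v (- 1) x.

(* v_{i,i-1} *)
Definition vprev (R : realType) (v : 'I_3 -> 'rV[R]_2)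
    (lamR : 'I_3 -> 'rV[R]_2 -> R) (i : 'I_3) (x : 'rV[R]_2) : R :=
  CT v / 2 * (lamR i x ^+ 2 - bary v i x ^+ 2)
    * (bary v (i - 1) x - bary v (i + 1) x)
  + CT v * bary v 0 x * bary v 1 x * bary v (- 1) x.

Definition wfun (R : realType) (v n : 'I_3 -> 'rV[R]_2)
    (lamR : 'I_3 -> 'rV[R]_2 -> R) (i : 'I_3) : tri v -> R^o :=
  sigL (tri v) (fun x => 1 / (4 * CT v * cnormal v n i)
    * (vprev v lamR (i + 1) x - vnext v lamR (i - 1) x)).
Arguments wfun {R} v n lamR i.

Definition W1 (R : realType) (v n : 'I_3 -> 'rV[R]_2)
    (lamR : 'I_3 -> 'rV[R]_2 -> R) : set (tri v -> R^o) :=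
  lspan [:: wfun v n lamR 0; wfun v n lamR 1; wfun v n lamR (- 1)].
Arguments W1 {R} v n lamR.

Definition U3 (R : realType) (v n : 'I_3 -> 'rV[R]_2)
    (lamR : 'I_3 -> 'rV[R]_2 -> R) : set (tri v -> R^o) :=
  sum2 (Poly 3 (tri v)) (W1 v n lamR).
Arguments U3 {R} v n lamR.

Definition Uv0 (R : realType) (v : 'I_3 -> 'rV[R]_2) (i : 'I_3) :
    set (tri v -> R^o) :=
  lspan [:: (sigL (tri v) (fun x => bary v i x ^+ 3) : tri v -> R^o)].
Arguments Uv0 {R} v i.

Definition Uv1 (R : realType) (v : 'I_3 -> 'rV[R]_2) (i : 'I_3) :
    set (tri v -> R^o) :=
  lspan [:: (sigL (tri v) (fun x => bary v i x ^+ 2 * bary v (i + 1) x)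
             : tri v -> R^o);
           sigL (tri v) (fun x => bary v i x ^+ 2 * bary v (i - 1) x)].
Arguments Uv1 {R} v i.

Definition ext (R : realType) (A : set 'rV[R]_2) (f : A -> R^o) :
  'rV[R]_2 -> R := 'valL_0 f.

Definition gradT (R : realType) (v : 'I_3 -> 'rV[R]_2) (f : tri v -> R^o) :
  'rV[R]_2 -> 'rV[R]_2 := grad (tri v) (ext f).

(* Integral over edge i of (df/dn) q ds. *)
Definition edge_dof (R : realType) (v n : 'I_3 -> 'rV[R]_2) (i : 'I_3)
    (q : edge v i -> R^o) (f : tri v -> R^o) : R :=
  line_integral (v (i + 1)) (v (i - 1))
    (fun x => dot (gradT f x) (n i) * ext q x).

Definition same_dofs (R : realType) (v n : 'I_3 -> 'rV[R]_2)
    (f g : tri v -> R^o) : Prop :=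
  [/\ forall i, ext f (v i) = ext g (v i),
      forall i, gradT f (v i) = gradT g (v i)
    & forall i (q : edge v i -> R^o), Poly 0 (edge v i) q ->
        edge_dof n q f = edge_dof n q g].

Lemma I3_ind (P : 'I_3 -> Prop) : P 0 -> P 1 -> P (- 1) -> forall i, P i.
Proof.
move=> P0 P1 P2 [[|[|[|//]]] h].
- by rewrite (_ : Ordinal h = 0)//; exact/val_inj.
- by rewrite (_ : Ordinal h = 1)//; exact/val_inj.
- by rewrite (_ : Ordinal h = - 1)//; exact/val_inj.
Qed.

Lemma sum_I3 (V : nmodType) (f : 'I_3 -> V) :
  \sum_(j < 3) f j = f 0 + f 1 + f (- 1).
Proof.
rewrite !big_ord_recr big_ord0 /= add0r.
by congr (f _ + f _ + f _); apply/val_inj.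
Qed.

Lemma cross_rot (R : realType) (a b c : 'rV[R]_2) : cross b c a = cross a b c.
Proof. by rewrite /cross; ring. Qed.

Lemma baryE (R : realType) (v : 'I_3 -> 'rV[R]_2) (x : 'rV[R]_2) :
  let D := cross (v 0) (v 1) (v (- 1)) in
  [/\ bary v 0 x = cross x (v 1) (v (- 1)) / D,
      bary v 1 x = cross x (v (- 1)) (v 0) / D
    & bary v (- 1) x = cross x (v 0) (v 1) / D].
Proof.
have e1 : 1 + 1 = - 1 :> 'I_3 by exact/val_inj.
have e2 : - 1 - 1 = 1 :> 'I_3 by exact/val_inj.
rewrite /bary e1 e2 addNr subrr sub0r add0r; split => //.
  by congr (_ / _); rewrite cross_rot.
by congr (_ / _); rewrite -cross_rot.
Qed.

Lemma baryP (R : realType) (v : 'I_3 -> 'rV[R]_2) (x : 'rV[R]_2) :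
  nondegenerate_tri v ->
  \sum_(i < 3) bary v i x = 1 /\ x = \sum_(i < 3) bary v i x *: v i.
Proof.
rewrite /nondegenerate_tri => D0; have [b0 b1 b2] := baryE v x.
rewrite !sum_I3 {}b0 {}b1 {}b2; split.
  by rewrite -!mulrDl -[RHS](divff D0) /cross; congr (_ / _); ring.
apply: (scalerI D0); apply/rowP => k; rewrite !mxE !mulrDr !mulrA.
rewrite -![_ * _ / _]mulrA.
rewrite ![_ * (_ / _)]mulrC !divfK // /cross.
case: k => [[|[|//]] hk].
- by rewrite (_ : Ordinal hk = 0); [ring|exact/val_inj].
- by rewrite (_ : Ordinal hk = 1); [ring|exact/val_inj].
Qed.

Lemma bary_affine (R : realType) (v : 'I_3 -> 'rV[R]_2) (i : 'I_3) :
  exists a b, forall x, bary v i x = dot a x + b.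
Proof.
set p := v (i + 1); set q := v (i - 1).
set d := cross (v i) p q.
exists (\row_(k < 2) (if k == 0 then (p 0 1 - q 0 1) / d else (q 0 0 - p 0 0) / d)).
exists ((p 0 0 * q 0 1 - p 0 1 * q 0 0) / d) => x.
rewrite /bary -/p -/q -/d /dot !big_ord_recr big_ord0 /= !mxE /=.
rewrite (_ : widen_ord _ _ = 0); last exact/val_inj.
rewrite (_ : ord_max = 1); last exact/val_inj.
by rewrite /cross; ring.
Qed.

Lemma bary_vertex (R : realType) (v : 'I_3 -> 'rV[R]_2) (i j : 'I_3) :
  nondegenerate_tri v -> bary v i (v j) = (i == j)%:R.
Proof.
rewrite /nondegenerate_tri => D0.
have D1 := D0; rewrite -cross_rot in D1; have D2 := D1; rewrite -cross_rot in D2.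
have [b0 b1 b2] := baryE v (v j).
have cx0 (a c : 'rV[R]_2) : cross a a c = 0 by rewrite /cross; ring.
have cx1 (a c : 'rV[R]_2) : cross a c a = 0 by rewrite /cross; ring.
elim/I3_ind: i; rewrite ?b0 ?b1 ?b2 {b0 b1 b2}; elim/I3_ind: j;
  rewrite ?cx0 ?cx1 ?mul0r // ?divff //.
- by rewrite (cross_rot (v 0)) divff.
- by rewrite -(cross_rot (v (- 1))) divff.
Qed.

Lemma refined_hat_exists (R : realType) (v : 'I_3 -> 'rV[R]_2) :
  nondegenerate_tri v ->
  forall i, refined_hat v i (fun x => bary v i x
    - Num.min (bary v 0 x) (Num.min (bary v 1 x) (bary v (- 1) x))).
Proof.
move=> D0 i.
have bc k : continuous (bary v k).
  have [a [b e]] := bary_affine v k.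
  have -> : bary v k = fun x => a 0 0 * x 0 0 + a 0 1 * x 0 1 + b.
    apply/funext => x; rewrite e /dot !big_ord_recr big_ord0 /= add0r.
    rewrite (_ : widen_ord _ _ = 0); last exact/val_inj.
    have -> : ord_max = 1 :> 'I_2 by exact/val_inj.
    by [].
  move=> x; have c0 := @coord_continuous R 1 2 0 0 x.
  have c1 := @coord_continuous R 1 2 0 1 x.
  have := cvgD (cvgD (cvgM (cvg_cst (a 0 0)) c0) (cvgM (cvg_cst (a 0 1)) c1))
    (cvg_cst b).
  by apply.
have hullE (j k : 'I_3) x : subtri v j x -> bary v j x <= bary v k x.
  case=> t [t0 t1 ->].
  have aff (f : 'rV[R]_2 -> R) (p : 'I_3 -> 'rV[R]_2) :
      (exists a b, forall x, f x = dot a x + b) ->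
      f (\sum_i t i *: p i) = \sum_i t i * f (p i).
    case=> a [b e]; rewrite e; under [RHS]eq_bigr do rewrite e mulrDr.
    rewrite big_split /= -mulr_suml t1 mul1r; congr (_ + _).
    rewrite /dot; under [RHS]eq_bigr do rewrite mulr_sumr.
    rewrite exchange_big /=; apply: eq_bigr => l _.
    rewrite summxE mulr_sumr; apply: eq_bigr => m _.
    by rewrite !mxE mulrCA.
  rewrite !aff; [|exact: bary_affine|exact: bary_affine].
  apply: ler_sum => m _; apply: ler_wpM2l => //.
  have bbc l : bary v l (barycenter v) = 3^-1.
    have [a [b e]] := bary_affine v l.
    have := bary_vertex l 0 D0; have := bary_vertex l 1 D0.
    have := bary_vertex l (- 1) D0; rewrite !e /barycenter => h1 h2 h3.
    have h : (l == 0)%:R + (l == 1)%:R + (l == - 1)%:R = 1 :> R.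
      by elim/I3_ind: l {e h1 h2 h3}; rewrite /= ?addr0 ?add0r.
    rewrite -h1 -h2 -h3 in h.
    have -> : dot a (3^-1 *: (v 0 + v 1 + v (-1))) =
       3^-1 * (dot a (v 0) + dot a (v 1) + dot a (v (-1))).
      rewrite /dot -!big_split /= mulr_sumr; apply: eq_bigr => q _.
      by rewrite !mxE; ring.
    lra.
  case: ifPn => [_|mj]; first by rewrite !bbc.
  by rewrite !bary_vertex // (eq_sym j) (negbTE mj) ler0n.
have minE (f : 'I_3 -> R) j : (forall k, f j <= f k) ->
    Num.min (f 0) (Num.min (f 1) (f (- 1))) = f j.
  move=> h; apply/eqP; rewrite eq_le; apply/andP; split.
    by elim/I3_ind: j {h}; rewrite !ge_min lexx ?orbT.
  by rewrite !le_min !h.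
split.
- apply: continuous_subspaceT => x.
  have m := continuous_min (bc 0 x) (continuous_min (bc 1 x) (bc (- 1) x)).
  exact: (cvgB (bc i x) m).
- move=> j; have [a [b e]] := bary_affine v i.
  have [a' [b' e']] := bary_affine v j.
  exists (a - a'), (b - b') => x xj.
  rewrite (minE (bary v ^~ x) j) => [|k]; last exact: hullE.
  rewrite e e' /dot opprD addrACA; congr (_ + _).
  by rewrite -sumrB; apply: eq_bigr => k _; rewrite !mxE mulrBl.
- rewrite !bary_vertex // eqxx.
  have [j ij] : exists j, i != j by elim/I3_ind: i; [exists 1|exists 0|exists 0].
  rewrite (minE (fun k => (k == i)%:R) j) ?(negbTE ij) ?subr0 // => [|k].
    by rewrite eq_sym (negbTE ij) subr0.
  by rewrite eq_sym (negbTE ij) ler0n.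
- have bbc : subtri v 0 (barycenter v) /\ subtri v 1 (barycenter v)
    /\ subtri v (- 1) (barycenter v).
    do !split; [exists (fun k => (k == 0)%:R)|exists (fun k => (k == 1)%:R)|
      exists (fun k => (k == - 1)%:R)]; split => //;
      rewrite !sum_I3 /= ?eqxx /= ?(scale0r, scale1r, addr0, add0r) //.
  have hi : subtri v i (barycenter v) by elim/I3_ind: i; case: bbc => ? [].
  rewrite (minE (bary v ^~ (barycenter v)) i) ?subrr // => k; exact: hullE.
- move=> j ji; rewrite !bary_vertex // eq_sym (negbTE ji).
  rewrite (minE (fun k => (k == j)%:R) i) => [|k]; rewrite eq_sym (negbTE ji) ?subr0 //.
Qed.

(* Main.v *)
Require Import Defs.
From mathcomp Require Import all_boot all_order all_algebra.
From mathcomp Require Import all_classical all_reals all_analysis.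
From mathcomp Require Import ring lra.
Import GRing.Theory.
Import Order.TTheory Num.Theory.
Import numFieldNormedType.Exports.
Local Open Scope classical_set_scope.
Local Open Scope ring_scope.

Set Implicit Arguments.
Unset Strict Implicit.
Unset Printing Implicit Defensive.

(** Let [mu] be the least of the three barycentric coordinates. On the triangle the
refined hat is [lambda_i^R = lambda_i - mu] ([refined_hat_lowest]), so on the
subtriangle [T_j], where [mu = lambda_j], the function [4 c_(i,i) w_i] is an
explicit cubic form in the barycentric coordinates ([wform], [wext_lowest]). The
numbers [c_(i,i)] are nonzero since the gradient of [lambda_i] and the normal are
both orthogonal to the same edge ([cnormal_neq0]).

Continuous differentiability. Seen as a function of [lambda] and [mu], the form
is stationary in [mu] wherever two coordinates equal [mu] ([wform_min_tie]).
Hence the gradients of the polynomial pieces agree on the common boundaries, and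
the pieces glue to a C1 function ([glue_lowest], [elt_grad]). Gradients relative
to the triangle are unique, so they can be computed on any piece.

Direct sum. Homogenising with [lambda_0 + lambda_1 + lambda_2 = 1], every cubic
polynomial is a combination of the ten cubic monomials in [lambda]
([polyfun_cubic_form]). Nine of them span the vertex spaces. The tenth, the bubble
[lambda_0 lambda_1 lambda_2], is a combination of the [w_i], because the three
cubic forms add up to six bubbles on every piece ([sum_wform], [bubble_wext]). So
[U3] consists of the functions [elt c g] given by twelve coefficients ([U3P]).

Unisolvence. The [w_i] and their gradients vanish at the vertices, so the value at
[v_i] is the coefficient of [lambda_i^3], and the gradient at [v_i] then gives the
coefficients of [lambda_i^2 lambda_m] ([elt_vertex], [gradT_vertex]). Along the
edge [e_i] the normal derivative of [4 c_(k,k) w_k] is [c_(i,i) lambda_(i+1)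
lambda_(i-1)] times 4 if [k = i] and times 1 otherwise ([wgrad_edge]). With fixed
cubic monomials, the edge moments are thus governed by the invertible matrix with
entries 4 on and 1 off the diagonal ([unisolvence]). Applied to the zero function,
unisolvence gives the linear independence of the twelve functions, hence the
directness of the sums and the dimension. *)

(** * The plane *)

Lemma dotE (R : realType) (x y : 'rV[R]_2) :
  dot x y = x 0 0 * y 0 0 + x 0 1 * y 0 1.
Proof.
rewrite /dot !big_ord_recl big_ord0 addr0.
by congr (x _ _ * y _ _ + x _ _ * y _ _); exact/val_inj.
Qed.

Lemma rv2P (R : realType) (x y : 'rV[R]_2) :
  x 0 0 = y 0 0 -> x 0 1 = y 0 1 -> x = y.
Proof.
move=> h0 h1; apply/rowP => -[[|[|//]] h].
- by rewrite (_ : Ordinal h = 0) //; exact/val_inj.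
- by rewrite (_ : Ordinal h = 1) //; exact/val_inj.
Qed.

Lemma dotDr (R : realType) (a x y : 'rV[R]_2) :
  dot a (x + y) = dot a x + dot a y.
Proof. by rewrite !dotE !mxE; ring. Qed.

Lemma dotBr (R : realType) (a x y : 'rV[R]_2) :
  dot a (x - y) = dot a x - dot a y.
Proof. by rewrite !dotE !mxE; ring. Qed.

Lemma dotZr (R : realType) (k : R) (a x : 'rV[R]_2) :
  dot a (k *: x) = k * dot a x.
Proof. by rewrite !dotE !mxE; ring. Qed.

Lemma dotDl (R : realType) (a b x : 'rV[R]_2) :
  dot (a + b) x = dot a x + dot b x.
Proof. by rewrite !dotE !mxE; ring. Qed.

Lemma dotBl (R : realType) (a b x : 'rV[R]_2) :
  dot (a - b) x = dot a x - dot b x.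
Proof. by rewrite !dotE !mxE; ring. Qed.

Lemma dotZl (R : realType) (k : R) (a x : 'rV[R]_2) :
  dot (k *: a) x = k * dot a x.
Proof. by rewrite !dotE !mxE; ring. Qed.

Lemma dot_suml (R : realType) (I : finType) (a : I -> 'rV[R]_2) x :
  dot (\sum_i a i) x = \sum_i dot (a i) x.
Proof.
rewrite dotE !summxE !mulr_suml -big_split; apply: eq_bigr => i _.
by rewrite dotE.
Qed.

Lemma enorm_ge0 (R : realType) (x : 'rV[R]_2) : 0 <= enorm x.
Proof. exact: sqrtr_ge0. Qed.

Lemma enorm_sqr (R : realType) (x : 'rV[R]_2) :
  enorm x ^+ 2 = x 0 0 ^+ 2 + x 0 1 ^+ 2.
Proof.
rewrite sqr_sqrtr dotE ?expr2 //.
by rewrite -!expr2 addr_ge0 // sqr_ge0.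
Qed.

Lemma enorm_gt0 (R : realType) (x : 'rV[R]_2) : x != 0 -> 0 < enorm x.
Proof.
move=> x0; rewrite lt_neqAle enorm_ge0 andbT eq_sym.
apply: contra x0 => /eqP e; have := enorm_sqr x; rewrite e expr0n /= => /esym.
move=> h; apply/eqP/rv2P; rewrite mxE; nra.
Qed.

Lemma enormZ (R : realType) (k : R) (x : 'rV[R]_2) :
  0 <= k -> enorm (k *: x) = k * enorm x.
Proof.
move=> k0; rewrite /enorm.
have -> : dot (k *: x) (k *: x) = k ^+ 2 * dot x x.
  by rewrite dotZl dotZr; ring.
by rewrite sqrtrM ?sqr_ge0 // sqrtr_sqr ger0_norm.
Qed.

Lemma enorm_le_coord (R : realType) (x : 'rV[R]_2) :
  enorm x <= `|x 0 0| + `|x 0 1|.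
Proof.
rewrite -(@ler_pXn2r _ 2) ?nnegrE ?enorm_ge0 ?addr_ge0 //.
rewrite enorm_sqr sqrrD !real_normK ?num_real // -addrA lerD2l lerDr.
by rewrite mulrn_wge0 // mulr_ge0.
Qed.

Lemma coord_le_enorm (R : realType) (x : 'rV[R]_2) k : `|x 0 k| <= enorm x.
Proof.
rewrite -(@ler_pXn2r _ 2) ?nnegrE ?enorm_ge0 //.
rewrite enorm_sqr real_normK ?num_real //.
case: k => [[|[|//]] h].
- by rewrite (_ : Ordinal h = 0) ?lerDl ?sqr_ge0 //; exact/val_inj.
- by rewrite (_ : Ordinal h = 1) ?lerDr ?sqr_ge0 //; exact/val_inj.
Qed.

Lemma dot_le_enorm (R : realType) (a x : 'rV[R]_2) :
  `|dot a x| <= (`|a 0 0| + `|a 0 1|) * enorm x.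
Proof.
rewrite dotE (le_trans (ler_normD _ _)) // !normrM mulrDl.
by rewrite lerD // ler_wpM2l // coord_le_enorm.
Qed.

Lemma near_enorm (R : realType) (x : 'rV[R]_2) (e : R) : 0 < e ->
  \forall y \near x, enorm (y - x) <= e.
Proof.
move=> e0; have e2 : 0 < e / 2 by rewrite divr_gt0.
have h k : \forall y \near x, `|x 0 k - (y : 'rV[R]_2) 0 k| <= e / 2.
  by move: (@coord_continuous R 1 2 0 k x) => /cvgrPdist_le; apply.
near=> y; apply: le_trans (enorm_le_coord _) _.
rewrite !mxE (splitr e) lerD // distrC; near: y; exact: h.
Unshelve. all: by end_near. Qed.

(** Both [a] and [b] are orthogonal to [c], so their determinant vanishes: they
are parallel as well as orthogonal. *)
Lemma orthogonal_triple (R : realType) (a b c : 'rV[R]_2) :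
  dot a b = 0 -> dot a c = 0 -> dot b c = 0 -> c != 0 -> a != 0 -> b = 0.
Proof.
rewrite !dotE => ab ac bc c0 a0.
have d0 : a 0 0 * b 0 1 - a 0 1 * b 0 0 = 0.
  apply/eqP; apply: contraNT c0 => d; apply/eqP/rv2P; rewrite mxE;
    apply: (mulfI d); rewrite mulr0.
    transitivity (b 0 1 * (a 0 0 * c 0 0 + a 0 1 * c 0 1)
      - a 0 1 * (b 0 0 * c 0 0 + b 0 1 * c 0 1)); first by ring.
    by rewrite ac bc; ring.
  transitivity (a 0 0 * (b 0 0 * c 0 0 + b 0 1 * c 0 1)
    - b 0 0 * (a 0 0 * c 0 0 + a 0 1 * c 0 1)); first by ring.
  by rewrite ac bc; ring.
have aa : a 0 0 ^+ 2 + a 0 1 ^+ 2 != 0.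
  by apply: contra a0 => /eqP h; apply/eqP/rv2P; rewrite mxE; nra.
apply: rv2P; rewrite mxE; apply: (mulfI aa); rewrite mulr0.
  transitivity (a 0 0 * (a 0 0 * b 0 0 + a 0 1 * b 0 1)
    - a 0 1 * (a 0 0 * b 0 1 - a 0 1 * b 0 0)); first by ring.
  by rewrite ab d0; ring.
transitivity (a 0 1 * (a 0 0 * b 0 0 + a 0 1 * b 0 1)
  + a 0 0 * (a 0 0 * b 0 1 - a 0 1 * b 0 0)); first by ring.
by rewrite ab d0; ring.
Qed.

(** * Gradients relative to a set *)

Lemma is_grad_affine (R : realType) (A : set 'rV[R]_2) (a : 'rV[R]_2) (b : R) x :
  is_grad A (fun y => dot a y + b) x a.
Proof.
move=> e e0; near=> y.
rewrite (_ : _ - _ - _ = 0) ?normr0 ?mulr_ge0 ?enorm_ge0 ?ltW //.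
by rewrite dotBr; ring.
Unshelve. all: by end_near. Qed.

Lemma is_gradD (R : realType) (A : set 'rV[R]_2) f f' x (g g' : 'rV[R]_2) :
  is_grad A f x g -> is_grad A f' x g' ->
  is_grad A (fun y => f y + f' y) x (g + g').
Proof.
move=> h h' e e0; have e2 : 0 < e / 2 by rewrite divr_gt0.
near=> y.
have hy : `|f y - f x - dot g (y - x)| <= e / 2 * enorm (y - x).
  by near: y; exact: h.
have hy' : `|f' y - f' x - dot g' (y - x)| <= e / 2 * enorm (y - x).
  by near: y; exact: h'.
rewrite dotDl (splitr e) mulrDl; apply: le_trans (lerD hy hy').
apply: le_trans (ler_normD _ _); rewrite le_eqVlt; apply/orP; left.
by apply/eqP; congr `| _ |; ring.
Unshelve. all: by end_near. Qed.

Lemma is_grad_cst (R : realType) (A : set 'rV[R]_2) (b : R) x :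
  is_grad A (fun=> b) x 0.
Proof.
move=> e e0; near=> y.
rewrite (_ : _ - _ - _ = 0) ?normr0 ?mulr_ge0 ?enorm_ge0 ?ltW //.
by rewrite dotE !mxE; ring.
Unshelve. all: by end_near. Qed.

Lemma is_grad_lipschitz (R : realType) (A : set 'rV[R]_2) f x (g : 'rV[R]_2) :
  is_grad A f x g -> exists2 K : R, 0 < K &
    \forall y \near within A (nbhs x), `|f y - f x| <= K * enorm (y - x).
Proof.
move=> h; exists (1 + (`|g 0 0| + `|g 0 1|)).
  by rewrite ltr_pwDl // addr_ge0.
near=> y.
have hy : `|f y - f x - dot g (y - x)| <= 1 * enorm (y - x).
  by near: y; exact: h.
rewrite mulrDl; apply: le_trans (lerD hy (dot_le_enorm _ _)).
by apply: le_trans (ler_normD _ _); rewrite subrK.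
Unshelve. all: by end_near. Qed.

(** The error is
[f x * (error of f') + f' x * (error of f) + (f y - f x) * (f' y - f' x)],
and the last term is quadratic in [y - x] because both functions are Lipschitz
at [x]. *)
Lemma is_gradM (R : realType) (A : set 'rV[R]_2) f f' x (g g' : 'rV[R]_2) :
  is_grad A f x g -> is_grad A f' x g' ->
  is_grad A (fun y => f y * f' y) x (f' x *: g + f x *: g').
Proof.
move=> h h' e e0.
have [K K0 hK] := is_grad_lipschitz h.
have [K' K'0 hK'] := is_grad_lipschitz h'.
pose m := `|f x| + `|f' x| + 1.
have m0 : 0 < m by rewrite ltr_pwDr // addr_ge0.
have e1 : 0 < e / (2 * m) by rewrite divr_gt0 // mulr_gt0.
have e2 : 0 < e / (2 * (K * K')) by rewrite divr_gt0 // !mulr_gt0.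
have hx : \forall y \near within A (nbhs x),
    enorm (y - x) <= e / (2 * (K * K')).
  by apply: cvg_within; exact: near_enorm.
near=> y.
have E1 : `|f y - f x - dot g (y - x)| <= e / (2 * m) * enorm (y - x).
  by near: y; exact: h.
have E2 : `|f' y - f' x - dot g' (y - x)| <= e / (2 * m) * enorm (y - x).
  by near: y; exact: h'.
have E3 : `|f y - f x| <= K * enorm (y - x) by near: y.
have E4 : `|f' y - f' x| <= K' * enorm (y - x) by near: y.
have E5 : enorm (y - x) <= e / (2 * (K * K')) by near: y.
set d := enorm (y - x) in E1 E2 E3 E4 E5 *.
have d0 : 0 <= d := enorm_ge0 _.
rewrite (_ : _ - _ - _ = f x * (f' y - f' x - dot g' (y - x))
  + f' x * (f y - f x - dot g (y - x)) + (f y - f x) * (f' y - f' x)); last first.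
  by rewrite dotDl !dotZl; ring.
apply: le_trans (ler_normD _ _) _; rewrite (splitr e) [leRHS]mulrDl; apply: lerD.
  apply: le_trans (ler_normD _ _) _; rewrite !normrM.
  apply: (@le_trans _ _ ((`|f x| + `|f' x|) * (e / (2 * m) * d))).
    by rewrite (mulrDl `|f x|) lerD // ler_wpM2l.
  apply: (@le_trans _ _ (m * (e / (2 * m) * d))).
    by rewrite ler_wpM2r ?lerDl // mulr_ge0 // ltW.
  by rewrite le_eqVlt; apply/orP; left; apply/eqP; field; rewrite gt_eqF.
rewrite normrM; apply: (@le_trans _ _ ((K * d) * (K' * d))).
  exact: ler_pM.
rewrite mulrACA mulrA ler_wpM2r //.
apply: (@le_trans _ _ (K * K' * (e / (2 * (K * K'))))).
  by rewrite ler_wpM2l // ltW // mulr_gt0.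
rewrite le_eqVlt; apply/orP; left; apply/eqP; field.
by rewrite !gt_eqF.
Unshelve. all: by end_near. Qed.

(** If [A] contains a segment from [x] in direction [d], difference quotients
along it are admissible, so they determine the slope of [f] along [d]. *)
Lemma is_grad_uniq_dir (R : realType) (A : set 'rV[R]_2) f x
    (g g' d : 'rV[R]_2) :
  is_grad A f x g -> is_grad A f x g' ->
  (forall s : R, 0 <= s <= 1 -> A (x + s *: d)) ->
  dot g d = dot g' d.
Proof.
move=> h h' Ad; apply/eqP; rewrite -subr_eq0 -normr_eq0 eq_le normr_ge0 andbT.
apply/ler_addgt0Pl => e e0; rewrite addr0.
have [->|d0] := eqVneq d 0; first by rewrite !dotE !mxE !mulr0 !addr0 subr0 normr0 ltW.
have n0 := enorm_gt0 d0.
have e1 : 0 < e / (2 * enorm d) by rewrite divr_gt0 // mulr_gt0.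
have H : \forall y \near x, A y ->
    `|f y - f x - dot g (y - x)| <= e / (2 * enorm d) * enorm (y - x) /\
    `|f y - f x - dot g' (y - x)| <= e / (2 * enorm d) * enorm (y - x).
  move: (h _ e1) (h' _ e1); rewrite !near_withinE => H1 H2; near=> y => Ay.
  by split; move: Ay; near: y.
have c : (fun s : R => x + s *: d) @ 0 --> x + 0 *: d.
  by apply: cvgD; [exact: cvg_cst|apply: cvgZr_tmp; exact: cvg_id].
rewrite scale0r addr0 in c.
have /nbhs_ballP[r /= r0 hr] := c _ H.
pose s := Num.min (r / 2) 1.
have s0 : 0 < s by rewrite lt_min divr_gt0 //=.
have s1 : s <= 1 by rewrite ge_min lexx orbT.
have sr : s < r by rewrite gt_min ltr_pdivrMr // mulr2n mulrDr mulr1 ltrDl r0.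
have := hr s; rewrite /ball /= sub0r normrN gtr0_norm // => /(_ sr).
rewrite /= => /(_ (Ad s _)) []; first by rewrite ltW.
rewrite (addrC x) addrK (enormZ _ (ltW s0)) !dotZr [s *: d + x]addrC => E1 E2.
have : `|s * dot g d - s * dot g' d| <= s * e.
  rewrite (_ : s * dot g d - s * dot g' d =
    (f (x + s *: d) - f x - s * dot g' d) - (f (x + s *: d) - f x - s * dot g d)).
    apply: le_trans (ler_normB _ _) _; apply: le_trans (lerD E2 E1) _.
    by rewrite le_eqVlt; apply/orP; left; apply/eqP; field; rewrite gt_eqF.
  by ring.
by rewrite -mulrBr normrM gtr0_norm // ler_pM2l.
Unshelve. all: by end_near. Qed.

(** * Continuously differentiable functions on the plane *)

(** The gradient is a parameter, and not [grad], so that the calculus rules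
compute it explicitly. *)
Definition smooth (R : realType) (f : 'rV[R]_2 -> R) (G : 'rV[R]_2 -> 'rV[R]_2) :=
  (forall x, is_grad setT f x (G x)) /\ continuous G.

Lemma eq_smooth (R : realType) (f f' : 'rV[R]_2 -> R) (G G' : 'rV[R]_2 -> 'rV[R]_2) :
  f =1 f' -> G =1 G' -> smooth f G -> smooth f' G'.
Proof. by move=> /funext -> /funext ->. Qed.

Lemma smooth_continuous (R : realType) (f : 'rV[R]_2 -> R) G :
  smooth f G -> continuous f.
Proof.
case=> h _ x; have [K K0 hK] := is_grad_lipschitz (h x).
rewrite near_withinE in hK.
apply: (proj2 (@cvgrPdist_le _ _ _ (nbhs x) (nbhs_filter x) f (f x))) => e e0.
have eK : 0 < e / K by rewrite divr_gt0.
apply: filterS (filterI hK (near_enorm x eK)) => y [/(_ I) h1 h2].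
by rewrite distrC (le_trans h1) // mulrC -ler_pdivlMr.
Qed.

Lemma smooth_cst (R : realType) (b : R) : smooth (fun=> b) (fun=> 0).
Proof. by split=> [x|x]; [exact: is_grad_cst|exact: cst_continuous]. Qed.

Lemma smooth_affine (R : realType) (a : 'rV[R]_2) (b : R) :
  smooth (fun x => dot a x + b) (fun=> a).
Proof. by split=> [x|x]; [exact: is_grad_affine|exact: cst_continuous]. Qed.

Lemma smoothD (R : realType) (f f' : 'rV[R]_2 -> R) G G' :
  smooth f G -> smooth f' G' ->
  smooth (fun x => f x + f' x) (fun x => G x + G' x).
Proof.
move=> [h c] [h' c']; split=> x; first exact: is_gradD.
exact: (cvgD (c x) (c' x)).
Qed.

Lemma smoothM (R : realType) (f f' : 'rV[R]_2 -> R) G G' :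
  smooth f G -> smooth f' G' ->
  smooth (fun x => f x * f' x) (fun x => f' x *: G x + f x *: G' x).
Proof.
move=> s s'; have [h c] := s; have [h' c'] := s'; split=> x.
  exact: is_gradM.
exact: (cvgD (cvgZ (smooth_continuous s' (x:=x)) (c x))
  (cvgZ (smooth_continuous s (x:=x)) (c' x))).
Qed.

Lemma smoothZ (R : realType) (k : R) (f : 'rV[R]_2 -> R) G :
  smooth f G -> smooth (fun x => k * f x) (fun x => k *: G x).
Proof.
move=> s; apply: eq_smooth (smoothM (smooth_cst k) s) => x //.
by rewrite scaler0 add0r.
Qed.

Lemma smooth_sum (R : realType) (I : finType) (f : I -> 'rV[R]_2 -> R) G :
  (forall i, smooth (f i) (G i)) ->
  smooth (fun x => \sum_i f i x) (fun x => \sum_i G i x).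
Proof.
move=> s; elim: (index_enum I) => [|i r IH].
  by apply: eq_smooth (smooth_cst 0) => x; rewrite big_nil.
by apply: eq_smooth (smoothD (s i) IH) => x; rewrite big_cons.
Qed.

(** * Barycentric coordinates *)

Lemma dot_inj (R : realType) (g g' : 'rV[R]_2) :
  (forall d, dot g d = dot g' d) -> g = g'.
Proof.
move=> h; apply: rv2P.
  by have := h (delta_mx 0 0); rewrite !dotE !mxE /= !mulr1 !mulr0 !addr0.
by have := h (delta_mx 0 1); rewrite !dotE !mxE /= !mulr1 !mulr0 !add0r.
Qed.

Lemma affine_comb (R : realType) (a : 'rV[R]_2) (b : R) (t : 'I_3 -> R)
    (p : 'I_3 -> 'rV[R]_2) : \sum_i t i = 1 ->
  dot a (\sum_i t i *: p i) + b = \sum_i t i * (dot a (p i) + b).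
Proof.
rewrite !sum_I3 => t1; rewrite !dotDr !dotZr -[b in LHS]mul1r -t1; ring.
Qed.

Lemma bary_comb (R : realType) (v : 'I_3 -> 'rV[R]_2) i (t : 'I_3 -> R)
    (p : 'I_3 -> 'rV[R]_2) : \sum_j t j = 1 ->
  bary v i (\sum_j t j *: p j) = \sum_j t j * bary v i (p j).
Proof.
move=> t1; have [a [b e]] := bary_affine v i.
by rewrite e affine_comb //; apply: eq_bigr => j _; rewrite e.
Qed.

Definition gradbary (R : realType) (v : 'I_3 -> 'rV[R]_2) i : 'rV[R]_2 :=
  grad setT (bary v i) (v i).

Lemma smooth_bary (R : realType) (v : 'I_3 -> 'rV[R]_2) i :
  smooth (bary v i) (fun=> gradbary v i).
Proof.
have [a [b /funext e]] := bary_affine v i.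
suff -> : gradbary v i = a by rewrite e; exact: smooth_affine.
have ga : is_grad setT (bary v i) (v i) a by rewrite e; exact: is_grad_affine.
by apply: dot_inj => d; apply: (is_grad_uniq_dir (xgetI 0 ga) ga).
Qed.

Lemma baryB (R : realType) (v : 'I_3 -> 'rV[R]_2) i (x y : 'rV[R]_2) :
  dot (gradbary v i) (y - x) = bary v i y - bary v i x.
Proof.
have [a [b /funext e]] := bary_affine v i.
have [s _] := smooth_bary v i; have := s x; rewrite e => h.
rewrite (is_grad_uniq_dir h (@is_grad_affine R setT a b x)) //.
by rewrite dotBr; ring.
Qed.

Lemma sum_bary (R : realType) (v : 'I_3 -> 'rV[R]_2) x :
  nondegenerate_tri v -> \sum_i bary v i x = 1.
Proof. by move=> /baryP h; have [] := h x. Qed.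

Lemma bary_combE (R : realType) (v : 'I_3 -> 'rV[R]_2) x :
  nondegenerate_tri v -> \sum_i bary v i x *: v i = x.
Proof. by move=> /baryP h; have [] := h x. Qed.

Lemma sum_delta (R : realType) (t : 'I_3 -> R) i : \sum_j t j * (i == j)%:R = t i.
Proof.
rewrite (bigD1 i) //= eqxx mulr1 big1 ?addr0 // => j ji.
by rewrite eq_sym (negbTE ji) mulr0.
Qed.

Lemma bary_hull (R : realType) (v : 'I_3 -> 'rV[R]_2) (t : 'I_3 -> R) i :
  nondegenerate_tri v -> \sum_j t j = 1 -> bary v i (\sum_j t j *: v j) = t i.
Proof.
move=> v0 t1; rewrite bary_comb //.
by under eq_bigr do rewrite bary_vertex //; rewrite sum_delta.
Qed.

Lemma triP (R : realType) (v : 'I_3 -> 'rV[R]_2) x :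
  nondegenerate_tri v -> tri v x <-> forall i, 0 <= bary v i x.
Proof.
move=> v0; split=> [[t [t0 t1 ->]] i|h]; first by rewrite bary_hull.
by exists (bary v ^~ x); split=> //; rewrite ?sum_bary ?bary_combE.
Qed.

Lemma tri_vertex (R : realType) (v : 'I_3 -> 'rV[R]_2) i :
  nondegenerate_tri v -> tri v (v i).
Proof. by move=> v0; apply/triP => // j; rewrite bary_vertex // ler0n. Qed.

Lemma tri_toward_vertex (R : realType) (v : 'I_3 -> 'rV[R]_2) x k (s : R) :
  nondegenerate_tri v -> tri v x -> 0 <= s <= 1 -> tri v (x + s *: (v k - x)).
Proof.
move=> v0 /(triP _ v0) x0 /andP[s0 s1]; apply/triP => // i.
have := baryB v i x (x + s *: (v k - x)).
rewrite (addrC x) addrK dotZr baryB bary_vertex // => h.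
rewrite -[leRHS](subrK (bary v i x)) -h.
rewrite (_ : _ + _ = s * (i == k)%:R + (1 - s) * bary v i x); last by ring.
by rewrite addr_ge0 // mulr_ge0 // ?ler0n ?subr_ge0.
Qed.

(** The directions from a point of the triangle to the three vertices span the
plane, so a gradient relative to the triangle is unique even on its boundary. *)
Lemma is_grad_tri_uniq (R : realType) (v : 'I_3 -> 'rV[R]_2) f x (g g' : 'rV[R]_2) :
  nondegenerate_tri v -> tri v x ->
  is_grad (tri v) f x g -> is_grad (tri v) f x g' -> g = g'.
Proof.
move=> v0 vx h h'; apply: dot_inj => d.
have e k : dot g (v k - x) = dot g' (v k - x).
  by apply: (is_grad_uniq_dir h h') => s; exact: tri_toward_vertex.
pose t i := bary v i (x + d).
have tE : \sum_i t i *: v i = x + d := bary_combE (x + d) v0.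
have t1 : \sum_i t i = 1 := sum_bary (x + d) v0.
have <- : \sum_i t i *: v i - x = d by rewrite tE addrC addKr.
have -> : \sum_i t i *: v i - x = \sum_i t i *: (v i - x).
  under [RHS]eq_bigr do rewrite scalerBr.
  by rewrite sumrB -scaler_suml t1 scale1r.
by rewrite sum_I3 !dotDr !dotZr !e.
Qed.

Lemma grad_tri (R : realType) (v : 'I_3 -> 'rV[R]_2) f x (g : 'rV[R]_2) :
  nondegenerate_tri v -> tri v x -> is_grad (tri v) f x g ->
  grad (tri v) f x = g.
Proof. by move=> v0 vx h; apply: (is_grad_tri_uniq v0 vx (xgetI 0 h) h). Qed.

(** * The barycentric refinement *)

(** Within the triangle this describes the subtriangle [T_j]; unlike the convex
hull it is visibly closed, and the three sets visibly cover the plane. *)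
Definition lowest (R : realType) (v : 'I_3 -> 'rV[R]_2) (j : 'I_3) (x : 'rV[R]_2) :=
  forall k, bary v j x <= bary v k x.

Lemma exists_lowest (R : realType) (v : 'I_3 -> 'rV[R]_2) x :
  exists j, lowest v j x.
Proof.
case: (arg_minP (fun j => bary v j x) (erefl : xpredT (0 : 'I_3))) => j _ h.
by exists j => k; exact: h.
Qed.

Lemma near_lowest (R : realType) (v : 'I_3 -> 'rV[R]_2) j (x : 'rV[R]_2) :
  \forall y \near x, lowest v j y -> lowest v j x.
Proof.
have [h|] := pselect (lowest v j x); first by near=> y.
move=> /existsNP[k /negP]; rewrite -ltNge -subr_gt0 => h.
have c : (fun y : 'rV[R]_2 => bary v j y - bary v k y) @ x -->
    bary v j x - bary v k x.
  by have := cvgB (smooth_continuous (smooth_bary v j) (x := x))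
    (smooth_continuous (smooth_bary v k) (x := x)); apply.
near=> y.
have yk : 0 < bary v j y - bary v k y by near: y; exact: (cvgr_gt _ c).
by move=> /(_ k); rewrite leNgt -subr_gt0 yk.
Unshelve. all: by end_near. Qed.

Lemma near_I3 (T : topologicalType) (x : T) (P : 'I_3 -> T -> Prop) :
  (forall j, \forall y \near x, P j y) -> \forall y \near x, forall j, P j y.
Proof.
move=> h; near=> y; elim/I3_ind; near: y; exact: h.
Unshelve. all: by end_near. Qed.

(** A function that is smooth on each of the three closed pieces is continuously
differentiable as soon as the gradients of the pieces agree on the common
boundaries: near [x], every point [y] lies in a piece that also contains [x]. *)
Lemma glue_lowest (R : realType) (v : 'I_3 -> 'rV[R]_2) (A : set 'rV[R]_2)
    (f : 'rV[R]_2 -> R) (p : 'I_3 -> 'rV[R]_2 -> R)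
    (G : 'I_3 -> 'rV[R]_2 -> 'rV[R]_2) :
  (forall j, smooth (p j) (G j)) ->
  (forall j x, A x -> lowest v j x -> f x = p j x) ->
  (forall j k x, lowest v j x -> lowest v k x -> G j x = G k x) ->
  exists H : 'rV[R]_2 -> 'rV[R]_2,
    [/\ forall x, A x -> is_grad A f x (H x),
        {within A, continuous H}
      & forall j x, lowest v j x -> H x = G j x].
Proof.
move=> sm fp GG.
pose H x := G (xget 0 [set j | lowest v j x]) x.
have HE j x : lowest v j x -> H x = G j x.
  by move=> jx; apply: (GG _ _ _ _ jx); exact: (@xgetI _ 0 [set k | lowest v k x] j jx).
exists H; split=> //.
  move=> x Ax e e0; rewrite near_withinE.
  have h j : \forall y \near x,
      `|p j y - p j x - dot (G j x) (y - x)| <= e * enorm (y - x).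
    by have := (sm j).1 x e e0; rewrite near_withinE; apply: filterS => y; exact.
  near=> y => Ay.
  have lo k : lowest v k y -> lowest v k x.
    move: k; near: y.
    apply: (near_I3 (P := fun k y => lowest v k y -> lowest v k x)) => k.
    exact: near_lowest.
  have hy k : `|p k y - p k x - dot (G k x) (y - x)| <= e * enorm (y - x).
    by move: k; near: y; exact: (near_I3 h).
  have [j jy] := exists_lowest v y; have jx := lo j jy.
  by rewrite (fp j y) // (fp j x) // (HE j x) //; exact: hy.
apply/subspace_continuousP => x Ax.
apply: (proj2 (@cvgrPdist_le _ _ _ (within A (nbhs x)) _ H (H x))) => e e0.
rewrite near_withinE.
have h j : \forall y \near x, `|G j x - G j y| <= e.
  exact: (proj1 (@cvgrPdist_le _ _ _ (nbhs x) _ (G j) (G j x)) ((sm j).2 x) e e0).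
near=> y => Ay.
have lo k : lowest v k y -> lowest v k x.
  move: k; near: y.
  apply: (near_I3 (P := fun k y => lowest v k y -> lowest v k x)) => k.
  exact: near_lowest.
have hy k : `|G k x - G k y| <= e by move: k; near: y; exact: (near_I3 h).
have [j jy] := exists_lowest v y; have jx := lo j jy.
by rewrite (HE j x) // (HE j y).
Unshelve. all: by end_near. Qed.

(** An affine function is determined by its vertex values, which for the refined
hat vanish at the barycenter and are 0 or 1 at the vertices of the
triangle. *)
Lemma refined_hat_affine (R : realType) (v : 'I_3 -> 'rV[R]_2) i j f x
    (t : 'I_3 -> R) :
  nondegenerate_tri v -> refined_hat v i f -> (forall k, 0 <= t k) ->
  \sum_k t k = 1 ->
  x = \sum_k t k *: (if k == j then barycenter v else v k) ->
  f x = \sum_(k | k != j) t k * (k == i)%:R.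
Proof.
move=> v0 [_ aff f1 fc f0] t0 t1 xE.
have [a [b e]] := aff j.
have pj k : subtri v j (if k == j then barycenter v else v k).
  exists (fun l => (l == k)%:R); split.
  - by move=> l; exact: ler0n.
  - by rewrite -[RHS](sum_delta (fun=> 1) k); apply: eq_bigr => l _; rewrite mul1r eq_sym.
  - rewrite (bigD1 k) //= eqxx scale1r big1 ?addr0 // => l /negbTE ->.
    by rewrite scale0r.
have xj : subtri v j x by exists t.
rewrite e // xE affine_comb // [LHS](bigD1 j) //= -e ?eqxx; last first.
  by have := pj j; rewrite eqxx.
rewrite fc mulr0 add0r; apply: eq_bigr => k kj; rewrite (negbTE kj) -e; last first.
  by have := pj k; rewrite (negbTE kj).
by have [->|/f0 ->] := eqVneq k i; rewrite ?f1.
Qed.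

(** Both sides are affine on [T_j] and agree at its three vertices. A point of
[T_j] is the convex combination with weight [3 lambda_j] at the barycenter and
[lambda_k - lambda_j] at the vertices [v_k]. *)
Lemma refined_hat_lowest (R : realType) (v : 'I_3 -> 'rV[R]_2) i j f x :
  nondegenerate_tri v -> refined_hat v i f -> tri v x -> lowest v j x ->
  f x = bary v i x - bary v j x.
Proof.
move=> v0 fi /(triP _ v0) x0 jx.
pose t k := if k == j then 3 * bary v j x else bary v k x - bary v j x.
have t0 k : 0 <= t k.
  by rewrite /t; case: ifP => _; rewrite ?subr_ge0 ?jx // mulr_ge0.
have s1 := sum_bary x v0; have sv := bary_combE x v0.
rewrite sum_I3 in s1; rewrite sum_I3 in sv.
have t1 : \sum_k t k = 1.
  by rewrite -s1 sum_I3 /t; elim/I3_ind: j {jx t t0} => /=; ring.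
have xE : x = \sum_k t k *: (if k == j then barycenter v else v k).
  rewrite -[LHS]sv sum_I3 /t /barycenter.
  by apply/rowP => l; elim/I3_ind: j {jx t t0 t1}; rewrite !mxE /=; field.
rewrite (refined_hat_affine v0 fi t0 t1 xE) /t.
rewrite big_mkcond sum_I3; elim/I3_ind: i {fi};
  elim/I3_ind: j {jx t t0 t1 xE} => /=; ring.
Qed.

(** * The extra functions on the subtriangles *)

Lemma I3_arith : (1 + 1 = - 1 :> 'I_3) * (- 1 - 1 = 1 :> 'I_3).
Proof. by split; exact/val_inj. Qed.

Lemma I3D1 (i : 'I_3) : i + 1 + 1 = i - 1.
Proof. by elim/I3_ind: i; exact/val_inj. Qed.

Lemma I3B1 (i : 'I_3) : i - 1 - 1 = i + 1.
Proof. by elim/I3_ind: i; exact/val_inj. Qed.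

Lemma sum_I3_at (V : zmodType) (i : 'I_3) (f : 'I_3 -> V) :
  \sum_j f j = f i + f (i + 1) + f (i - 1).
Proof.
rewrite sum_I3; elim/I3_ind: i; rewrite ?(add0r, sub0r, subrr, addNr, I3_arith).
- by [].
- by rewrite -addrA addrC.
- by rewrite addrC addrA.
Qed.

(** With [mu] the least barycentric coordinate, [lambda_k^R = lambda_k - mu], so
[(lambda_k^R)^2 - lambda_k^2 = mu^2 - 2 mu lambda_k]. Substituting this in [w_i]
and putting [mu = l j] gives [4 c_(i,i) w_i] on [T_j] as this cubic form. *)
Definition wform (R : realType) (i j : 'I_3) (l : 'I_3 -> R) : R :=
  l j ^+ 2 / 2 * (2 * l i - l (i + 1) - l (i - 1))
  - l j * (l i * (l (i + 1) + l (i - 1)) - 2 * l (i + 1) * l (i - 1))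
  + 2 * l i * l (i + 1) * l (i - 1).

(** The partial derivative of [wform i j l] in the slot occupied by the minimum
[mu = l j], the other occurrences of the coordinates being held fixed. *)
Definition wform_min (R : realType) (i j : 'I_3) (l : 'I_3 -> R) : R :=
  l j * (2 * l i - l (i + 1) - l (i - 1))
  - (l i * (l (i + 1) + l (i - 1)) - 2 * l (i + 1) * l (i - 1)).

Definition wgrad (R : realType) (v : 'I_3 -> 'rV[R]_2) (i j : 'I_3)
    (l : 'I_3 -> R) : 'rV[R]_2 :=
  (l j ^+ 2 - l j * (l (i + 1) + l (i - 1)) + 2 * l (i + 1) * l (i - 1))
    *: gradbary v i
  + (- (l j ^+ 2 / 2) - l j * (l i - 2 * l (i - 1)) + 2 * l i * l (i - 1))
    *: gradbary v (i + 1)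
  + (- (l j ^+ 2 / 2) - l j * (l i - 2 * l (i + 1)) + 2 * l i * l (i + 1))
    *: gradbary v (i - 1)
  + wform_min i j l *: gradbary v j.

Lemma smooth_wform (R : realType) (v : 'I_3 -> 'rV[R]_2) i j :
  smooth (fun x => wform i j (bary v ^~ x)) (fun x => wgrad v i j (bary v ^~ x)).
Proof.
have s k := smooth_bary v k.
have m := smoothM (s j) (s j).
(* The four products are the terms of [wform] in [mu^2], in [mu l_i], in
   [mu l_(i+1) l_(i-1)], and without [mu]. *)
have h1 := smoothM m (smoothD (s i)
  (smoothZ (- (1 / 2)) (smoothD (s (i + 1)) (s (i - 1))))).
have h2 := smoothZ (- 1) (smoothM (s j) (smoothM (s i)
  (smoothD (s (i + 1)) (s (i - 1))))).
have h3 := smoothZ 2 (smoothM (s j) (smoothM (s (i + 1)) (s (i - 1)))).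
have h4 := smoothZ 2 (smoothM (s i) (smoothM (s (i + 1)) (s (i - 1)))).
apply: eq_smooth (smoothD (smoothD h1 h2) (smoothD h3 h4)) => x.
  by rewrite /wform; field.
rewrite /wgrad /wform_min.
move: (gradbary v i) (gradbary v (i + 1)) (gradbary v (i - 1)) (gradbary v j).
move: (bary v i x) (bary v (i + 1) x) (bary v (i - 1) x) (bary v j x).
by move=> a b c d a' b' c' d'; apply/rowP => k; rewrite !mxE; field.
Qed.

(** Where two coordinates attain the minimum, the form is stationary in [mu].
Hence switching from [mu = l j] to [mu = l k] there does not change the
gradient, which is what makes [w_i] continuously differentiable. *)
Lemma wform_min_tie (R : realType) (i j k : 'I_3) (l : 'I_3 -> R) :
  j != k -> l j = l k -> wform_min i j l = 0.
Proof.
rewrite /wform_min => + ljk.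
elim/I3_ind: i; elim/I3_ind: j ljk; elim/I3_ind: k => ljk //= _;
  rewrite ?(add0r, sub0r, subrr, addNr, I3_arith) ljk; ring.
Qed.

Lemma wgrad_tie (R : realType) (v : 'I_3 -> 'rV[R]_2) i j k (l : 'I_3 -> R) :
  l j = l k -> wgrad v i j l = wgrad v i k l.
Proof.
move=> e; have [->//|jk] := eqVneq j k.
have mj : wform_min i j l = 0 by exact: wform_min_tie e.
have mk : wform_min i k l = 0.
  by apply: (@wform_min_tie _ i k j); rewrite // eq_sym.
rewrite /wgrad.
rewrite mj mk !scale0r.
by rewrite e.
Qed.

Lemma lowest_tie (R : realType) (v : 'I_3 -> 'rV[R]_2) j k x :
  lowest v j x -> lowest v k x -> bary v j x = bary v k x.
Proof. by move=> h1 h2; apply/eqP; rewrite eq_le h1 h2. Qed.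

Lemma sum_wform (R : realType) j (l : 'I_3 -> R) :
  \sum_i wform i j l = 6 * (l 0 * l 1 * l (- 1)).
Proof.
by rewrite sum_I3 /wform !(add0r, sub0r, subrr, addNr, I3_arith); field.
Qed.

(** Where [mu = l i = 0], only the terms of first order in [mu] and [l i] have a
nonzero derivative: the bubble contributes 2, and the part linear in [mu]
contributes 2 on the own edge ([k = i]) and -1 on the other edges. *)
Lemma wgrad_edge (R : realType) (v : 'I_3 -> 'rV[R]_2) k i (l : 'I_3 -> R) :
  l i = 0 ->
  wgrad v k i l = ((1 + 3 * (k == i)%:R) * (l (i + 1) * l (i - 1))) *: gradbary v i.
Proof.
rewrite /wgrad /wform_min => li.
move: (gradbary v) => g.
elim/I3_ind: i li => li; elim/I3_ind: k;
  rewrite ?(add0r, sub0r, subrr, addNr, I3_arith) li /=;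
  move: (g 0) (g 1) (g (- 1)) (l 0) (l 1) (l (- 1)) => g0 g1 g2 l0 l1 l2;
  apply/rowP => m; rewrite !mxE; ring.
Qed.

(** Two vanishing coordinates single out a vertex. *)
Lemma wform_vertex (R : realType) k i (l : 'I_3 -> R) : l i = 0 -> l (i + 1) = 0 ->
  wform k i l = 0.
Proof.
rewrite /wform.
elim/I3_ind: i; elim/I3_ind: k;
  rewrite ?(add0r, sub0r, subrr, addNr, I3_arith) => -> ->; ring.
Qed.

Lemma I3_neqD1 (i : 'I_3) : i + 1 != i.
Proof. by elim/I3_ind: i. Qed.

Lemma I3_neqB1 (i : 'I_3) : i - 1 != i.
Proof. by elim/I3_ind: i. Qed.

Lemma I3_neqD1B1 (i : 'I_3) : i - 1 != i + 1.
Proof. by elim/I3_ind: i. Qed.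

Lemma gradbary_edge (R : realType) (v : 'I_3 -> 'rV[R]_2) i p q :
  nondegenerate_tri v -> p != i -> q != i ->
  dot (gradbary v i) (v p - v q) = 0.
Proof.
move=> v0 pi qi; rewrite baryB !bary_vertex //.
by rewrite !(eq_sym i) (negbTE pi) (negbTE qi) subrr.
Qed.

Lemma gradbary_neq0 (R : realType) (v : 'I_3 -> 'rV[R]_2) i :
  nondegenerate_tri v -> gradbary v i != 0.
Proof.
move=> v0; apply/eqP => h; have := I3_neqD1 i; move: (i + 1) => p pi.
have := baryB v i (v p) (v i).
rewrite h !bary_vertex // eqxx eq_sym (negbTE pi) dotE !mxE !mul0r addr0 subr0.
by move/eqP; rewrite eq_sym oner_eq0.
Qed.

Lemma vertex_inj (R : realType) (v : 'I_3 -> 'rV[R]_2) :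
  nondegenerate_tri v -> injective v.
Proof.
move=> v0 i j e; have := bary_vertex i i v0; rewrite e bary_vertex // eqxx.
by case: eqVneq => // _ /eqP; rewrite eq_sym oner_eq0.
Qed.

Lemma edge_neq0 (R : realType) (v : 'I_3 -> 'rV[R]_2) i :
  nondegenerate_tri v -> v (i - 1) - v (i + 1) != 0.
Proof.
move=> v0; rewrite subr_eq0; apply/eqP => /(vertex_inj v0).
by apply/eqP/I3_neqD1B1.
Qed.

Lemma unit_normal_neq0 (R : realType) (v : 'I_3 -> 'rV[R]_2) i (n : 'rV[R]_2) :
  unit_normal v i n -> n != 0.
Proof.
case=> n1 _; apply/eqP => n0; move: n1; rewrite n0 /enorm dotE !mxE !mulr0 addr0.
by rewrite sqrtr0 => /eqP; rewrite eq_sym oner_eq0.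
Qed.

(** The gradient of [lambda_i] and the normal are both orthogonal to the edge, so
they cannot also be orthogonal to each other. *)
Lemma cnormal_neq0 (R : realType) (v n : 'I_3 -> 'rV[R]_2) i :
  nondegenerate_tri v -> unit_normal v i (n i) -> cnormal v n i != 0.
Proof.
move=> v0 un; have [_ nt] := un; apply/eqP => gn.
have := unit_normal_neq0 un; rewrite (_ : n i = 0) ?eqxx //.
have gt := gradbary_edge v0 (I3_neqB1 i) (I3_neqD1 i).
exact: (orthogonal_triple gn gt nt (edge_neq0 i v0) (gradbary_neq0 i v0)).
Qed.

Lemma CT_neq0 (R : realType) (v : 'I_3 -> 'rV[R]_2) :
  nondegenerate_tri v -> CT v != 0.
Proof.
move=> v0; rewrite /CT /area !mulf_neq0 ?expf_neq0 ?mulf_neq0 ?normr_eq0 //;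
  by rewrite ?invr_neq0 // pnatr_eq0.
Qed.

(** The formula defining [w_i], before restriction to the triangle. *)
Definition wext (R : realType) (v n : 'I_3 -> 'rV[R]_2)
    (lamR : 'I_3 -> 'rV[R]_2 -> R) (i : 'I_3) (x : 'rV[R]_2) : R :=
  1 / (4 * CT v * cnormal v n i)
    * (vprev v lamR (i + 1) x - vnext v lamR (i - 1) x).

Lemma wext_lowest (R : realType) (v n : 'I_3 -> 'rV[R]_2) lamR i j x :
  nondegenerate_tri v -> (forall i, unit_normal v i (n i)) ->
  (forall i, refined_hat v i (lamR i)) -> tri v x -> lowest v j x ->
  wext v n lamR i x = wform i j (bary v ^~ x) / (4 * cnormal v n i).
Proof.
move=> v0 un hat vx jx.
have lp : CT v * bary v 0 x * bary v 1 x * bary v (- 1) x =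
    CT v * (bary v i x * bary v (i + 1) x * bary v (i - 1) x).
  transitivity (CT v * (bary v 0 x * bary v 1 x * bary v (- 1) x)).
    by rewrite !mulrA.
  congr (_ * _).
  by elim/I3_ind: i; rewrite ?(add0r, sub0r, subrr, addNr, I3_arith); ring.
have cn := cnormal_neq0 v0 (un i); have ct := CT_neq0 v0.
rewrite /wext /vprev /vnext lp !(refined_hat_lowest v0 (hat _) vx jx).
rewrite I3D1 I3B1 addrK subrK /wform.
move: (bary v i x) (bary v (i + 1) x) (bary v (i - 1) x) (bary v j x).
by move: (CT v) (cnormal v n i) ct cn => C c C0 c0 *; field; rewrite C0 c0.
Qed.

(** * Cubic polynomials in barycentric coordinates *)

Definition bern (R : realType) (v : 'I_3 -> 'rV[R]_2) (p m : 'I_3) (x : 'rV[R]_2) : R :=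
  bary v p x ^+ 2 * bary v m x.

Lemma polyfun3E (R : realType) (c : nat -> nat -> R) (x : 'rV[R]_2) :
  let X := x 0 0 in let Y := x 0 1 in
  polyfun 3 c x = c 0 0 + c 0 1 * Y + c 0 2 * Y ^+ 2 + c 0 3 * Y ^+ 3
    + c 1 0 * X + c 1 1 * X * Y + c 1 2 * X * Y ^+ 2
    + c 2 0 * X ^+ 2 + c 2 1 * X ^+ 2 * Y + c 3 0 * X ^+ 3.
Proof.
rewrite /polyfun; under eq_bigr do rewrite big_mkcond.
by rewrite !big_ord_recl !big_ord0 /=; ring.
Qed.

Lemma polyfun_prod_affine (R : realType) (f : 'I_3 -> 'rV[R]_2 -> R) :
  (forall k, exists a b, forall x, f k x = dot a x + b) ->
  exists c, forall x, f 0 x * f 1 x * f (- 1) x = polyfun 3 c x.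
Proof.
move=> h; have [a [b e]] := h 0; have [a' [b' e']] := h 1.
have [a'' [b'' e'']] := h (- 1).
move: (a 0 0) (a 0 1) (a' 0 0) (a' 0 1) (a'' 0 0) (a'' 0 1) (dotE a) (dotE a')
  (dotE a'') => p q p' q' p'' q'' d d' d''.
exists (fun i j => match i, j with
  | 0%N, 0%N => b * b' * b''
  | 0%N, 1%N => q * b' * b'' + b * q' * b'' + b * b' * q''
  | 0%N, 2%N => q * q' * b'' + q * b' * q'' + b * q' * q''
  | 0%N, 3%N => q * q' * q''
  | 1%N, 0%N => p * b' * b'' + b * p' * b'' + b * b' * p''
  | 1%N, 1%N => p * q' * b'' + p * b' * q'' + q * p' * b'' + b * p' * q''
            + q * b' * p'' + b * q' * p''
  | 1%N, 2%N => p * q' * q'' + q * p' * q'' + q * q' * p''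
  | 2%N, 0%N => p * p' * b'' + p * b' * p'' + b * p' * p''
  | 2%N, 1%N => p * p' * q'' + p * q' * p'' + q * p' * p''
  | 3%N, 0%N => p * p' * p''
  | _, _ => 0 end) => x.
by rewrite polyfun3E /= e e' e'' d d' d''; ring.
Qed.

Lemma polyfunD (R : realType) (c d : nat -> nat -> R) (k : R) x :
  polyfun 3 (fun i j => c i j + k * d i j) x = polyfun 3 c x + k * polyfun 3 d x.
Proof. by rewrite !polyfun3E; ring. Qed.

Lemma polyfun_bern (R : realType) (v : 'I_3 -> 'rV[R]_2) p m :
  exists c, forall x, bern v p m x = polyfun 3 c x.
Proof.
have [|c e] := @polyfun_prod_affine R (fun k => bary v (if k == - 1 then m else p)).
  by move=> k; exact: bary_affine.
by exists c => x; rewrite -e.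
Qed.

Lemma polyfun_sum (R : realType) (I : finType) (k : I -> R) (f : I -> 'rV[R]_2 -> R) :
  (forall i, exists c, forall x, f i x = polyfun 3 c x) ->
  exists c, forall x, \sum_i k i * f i x = polyfun 3 c x.
Proof.
move=> h; elim: (index_enum I) => [|i r [c IH]].
  by exists (fun _ _ => 0) => x; rewrite big_nil polyfun3E; ring.
have [d e] := h i; exists (fun a b => c a b + k i * d a b) => x.
by rewrite big_cons polyfunD -e -IH addrC.
Qed.

Definition bern_comb (R : realType) (v : 'I_3 -> 'rV[R]_2) (c : 'I_3 -> 'I_3 -> R)
    (x : 'rV[R]_2) : R :=
  \sum_p \sum_m c p m * bern v p m x.

Lemma polyfun_bern_comb (R : realType) (v : 'I_3 -> 'rV[R]_2) c :
  exists d, forall x, bern_comb v c x = polyfun 3 d x.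
Proof.
have [|d e] := @polyfun_sum R 'I_3 (fun=> 1) (fun p x => \sum_m c p m * bern v p m x).
  by move=> p; apply: polyfun_sum => m; exact: polyfun_bern.
by exists d => x; rewrite -e /bern_comb; under [RHS]eq_bigr do rewrite mul1r.
Qed.

Lemma bern_combD (R : realType) (v : 'I_3 -> 'rV[R]_2) (k : R) c d x :
  bern_comb v (fun p m => c p m + k * d p m) x
  = bern_comb v c x + k * bern_comb v d x.
Proof.
rewrite /bern_comb mulr_sumr -big_split; apply: eq_bigr => p _ /=.
rewrite mulr_sumr -big_split; apply: eq_bigr => m _ /=; ring.
Qed.

(** The products [lambda_p^2 lambda_m] are all the cubic monomials in [lambda]
except the bubble [lambda_0 lambda_1 lambda_2]. *)
Definition cubic_form (R : realType) (v : 'I_3 -> 'rV[R]_2) (f : 'rV[R]_2 -> R) :=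
  exists c e, forall x,
    f x = bern_comb v c x + e * (bary v 0 x * bary v 1 x * bary v (- 1) x).

Lemma cubic_formD (R : realType) (v : 'I_3 -> 'rV[R]_2) (k : R) f g :
  cubic_form v f -> cubic_form v g -> cubic_form v (fun x => f x + k * g x).
Proof.
move=> [c [e h]] [c' [e' h']].
exists (fun p m => c p m + k * c' p m), (e + k * e') => x.
by rewrite h h' bern_combD; ring.
Qed.

Lemma cubic_form_prod (R : realType) (v : 'I_3 -> 'rV[R]_2) (a b c : 'I_3 -> R) :
  cubic_form v (fun x => (\sum_i a i * bary v i x) * (\sum_i b i * bary v i x)
    * (\sum_i c i * bary v i x)).
Proof.
exists (fun p m => if p == m then a p * b p * c p else
  a p * b p * c m + a p * b m * c p + a m * b p * c p).
exists (a 0 * b 1 * c (- 1) + a 0 * b (- 1) * c 1 + a 1 * b 0 * c (- 1)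
  + a 1 * b (- 1) * c 0 + a (- 1) * b 0 * c 1 + a (- 1) * b 1 * c 0) => x.
rewrite /bern_comb !sum_I3 /bern /=.
move: (bary v 0 x) (bary v 1 x) (bary v (- 1) x) => l0 l1 l2.
move: (a 0) (a 1) (a (- 1)) (b 0) (b 1) (b (- 1)) (c 0) (c 1) (c (- 1)) => *.
ring.
Qed.

(** Homogenise with [lambda_0 + lambda_1 + lambda_2 = 1] and with the expression
of the Cartesian coordinates in barycentric ones. *)
Lemma polyfun_cubic_form (R : realType) (v : 'I_3 -> 'rV[R]_2) c :
  nondegenerate_tri v -> cubic_form v (polyfun 3 c).
Proof.
move=> v0.
pose h (a : nat) i : R := match a with 0%N => 1 | 1%N => v i 0 0 | _ => v i 0 1 end.
pose lin a x := \sum_i h a i * bary v i x.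
have l0 x : lin 0%N x = 1.
  by rewrite /lin /h; under eq_bigr do rewrite mul1r; exact: sum_bary.
have lk (k : 'I_2) x : \sum_i v i 0 k * bary v i x = x 0 k.
  rewrite -[in RHS](bary_combE x v0) summxE; apply: eq_bigr => i _.
  by rewrite mxE mulrC.
have l1 x : lin 1%N x = x 0 0 by exact: lk.
have l2 x : lin 2%N x = x 0 1 by exact: lk.
have m a b d : cubic_form v (fun x => lin a x * lin b x * lin d x).
  exact: cubic_form_prod.
have z : cubic_form v (fun=> 0).
  exists (fun _ _ => 0), 0 => x; rewrite mul0r addr0 /bern_comb.
  by rewrite big1 // => p _; rewrite big1 // => q _; rewrite mul0r.
have := z.
move=> /(cubic_formD (c 0 0)%N)/(_ (m 0 0 0)%N).
move=> /(cubic_formD (c 0 1)%N)/(_ (m 0 0 2)%N).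
move=> /(cubic_formD (c 0 2)%N)/(_ (m 0 2 2)%N).
move=> /(cubic_formD (c 0 3)%N)/(_ (m 2 2 2)%N).
move=> /(cubic_formD (c 1 0)%N)/(_ (m 0 0 1)%N).
move=> /(cubic_formD (c 1 1)%N)/(_ (m 0 1 2)%N).
move=> /(cubic_formD (c 1 2)%N)/(_ (m 1 2 2)%N).
move=> /(cubic_formD (c 2 0)%N)/(_ (m 0 1 1)%N).
move=> /(cubic_formD (c 2 1)%N)/(_ (m 1 1 2)%N).
move=> /(cubic_formD (c 3 0)%N)/(_ (m 1 1 1)%N).
move=> [d [e de]]; exists d, e => x; rewrite -de !l0 !l1 !l2 polyfun3E; ring.
Qed.

(** * The space [U3] and its coefficients *)

(** The twelve coefficients are stored as [c p m] for [lambda_p^2 lambda_m], with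
[p = m] for the cubes, and [g i] for [w_i]. Every space in the theorem consists
of the functions of this form whose coefficients vanish at prescribed places. *)
Definition elt (R : realType) (v n : 'I_3 -> 'rV[R]_2) lamR
    (c : 'I_3 -> 'I_3 -> R) (g : 'I_3 -> R) : tri v -> R^o :=
  sigL (tri v) (fun x => bern_comb v c x + \sum_i g i * wext v n lamR i x).

Lemma eq_sigL (R : realType) (A : set 'rV[R]_2) (f g : 'rV[R]_2 -> R) :
  (forall x, A x -> f x = g x) -> (sigL A f : A -> R^o) = sigL A g.
Proof. by move=> h; apply/eq_sigLP => x /set_mem; exact: h. Qed.

Lemma lspan1P (R : realType) (V : lmodType R) (a : V) u :
  lspan [:: a] u <-> exists k, u = k *: a.
Proof.
split=> [[c ->]|[k ->]]; first by exists (c ord0); rewrite big_ord_recl big_ord0 addr0.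
by exists (fun=> k); rewrite big_ord_recl big_ord0 addr0.
Qed.

Lemma lspan2P (R : realType) (V : lmodType R) (a b : V) u :
  lspan [:: a; b] u <-> exists k l, u = k *: a + l *: b.
Proof.
split=> [[c ->]|[k [l ->]]].
  by exists (c ord0), (c (lift ord0 ord0)); rewrite !big_ord_recl big_ord0 addr0.
exists (fun i => if val i == 0%N then k else l).
by rewrite !big_ord_recl big_ord0 addr0.
Qed.

Lemma lspan3P (R : realType) (V : lmodType R) (f : 'I_3 -> V) u :
  lspan [:: f 0; f 1; f (- 1)] u <-> exists k : 'I_3 -> R, u = \sum_i k i *: f i.
Proof.
split=> [[c ->]|[k ->]].
  exists c; apply: eq_bigr; apply: I3_ind => _ //.
by exists k; apply: eq_bigr; apply: I3_ind => _ //.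
Qed.

Lemma W1P (R : realType) (v n : 'I_3 -> 'rV[R]_2) lamR f :
  W1 v n lamR f <-> exists g, f = elt n lamR (fun _ _ => 0) g.
Proof.
have e g : elt n lamR (fun _ _ => 0) g = \sum_i g i *: wfun v n lamR i.
  apply/funext => x; rewrite fct_sumE /elt /= /bern_comb big1 ?add0r // => p _.
  by rewrite big1 // => m _; rewrite mul0r.
rewrite /W1 lspan3P; split=> -[g ->]; exists g; rewrite e //.
Qed.

Lemma vertex_spaceE (R : realType) (v : 'I_3 -> 'rV[R]_2) i (c : 'I_3 -> R) :
  sigL (tri v) (fun x => \sum_m c m * bern v i m x) =
  c i *: (sigL (tri v) (fun x => bary v i x ^+ 3) : tri v -> R^o) +
  (c (i + 1) *: (sigL (tri v) (fun x => bary v i x ^+ 2 * bary v (i + 1) x)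
                 : tri v -> R^o)
  + c (i - 1) *: (sigL (tri v) (fun x => bary v i x ^+ 2 * bary v (i - 1) x)
                 : tri v -> R^o)).
Proof. by apply/funext => x; rewrite /= (sum_I3_at i) -addrA /bern -exprSr. Qed.

Lemma sum_vertex_elt (R : realType) (v n : 'I_3 -> 'rV[R]_2) lamR c :
  \sum_i (sigL (tri v) (fun x => \sum_m c i m * bern v i m x) : tri v -> R^o)
  = elt n lamR c (fun=> 0).
Proof.
apply/funext => x; rewrite fct_sumE /elt /= [X in _ = _ + X]big1 ?addr0 // => i _.
by rewrite mul0r.
Qed.

Definition I3_case (T : Type) (i : 'I_3) (a b c : T) (j : 'I_3) : T :=
  if j == i then a else if j == i + 1 then b else c.

Lemma I3_caseE (T : Type) (i : 'I_3) (a b c : T) :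
  [/\ I3_case i a b c i = a, I3_case i a b c (i + 1) = b
    & I3_case i a b c (i - 1) = c].
Proof.
rewrite /I3_case !eqxx (negbTE (I3_neqD1 i)) (negbTE (I3_neqB1 i)).
by rewrite (negbTE (I3_neqD1B1 i)).
Qed.

Lemma vertex_spaceP (R : realType) (v : 'I_3 -> 'rV[R]_2) i f :
  sum2 (Uv0 v i) (Uv1 v i) f <->
  exists c : 'I_3 -> R, f = sigL (tri v) (fun x => \sum_m c m * bern v i m x).
Proof.
split=> [[a /lspan1P[k ->] [b /lspan2P[l [m ->]] <-]]|[c ->]].
  by exists (I3_case i k l m); have [e1 e2 e3] := I3_caseE i k l m;
    rewrite vertex_spaceE e1 e2 e3.
rewrite vertex_spaceE; eexists; first by apply/lspan1P; exists (c i).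
by eexists; first by apply/lspan2P; exists (c (i + 1)), (c (i - 1)).
Qed.

Lemma sum_vertex_spacesP (R : realType) (v n : 'I_3 -> 'rV[R]_2) lamR f :
  sumI (fun i => sum2 (Uv0 v i) (Uv1 v i)) f <->
  exists c, f = elt n lamR c (fun=> 0).
Proof.
split=> [[u hu ->]|[c ->]].
  have [c hc] := choice (fun i => (vertex_spaceP (v:=v) i (u i)).1 (hu i)).
  by exists c; rewrite -sum_vertex_elt; apply: eq_bigr => i _; rewrite hc.
rewrite -sum_vertex_elt; eexists; last by [].
by move=> i; apply/vertex_spaceP; exists (c i).
Qed.

Lemma eltD (R : realType) (v n : 'I_3 -> 'rV[R]_2) lamR c g c' g' :
  elt (v := v) n lamR c g + elt n lamR c' g' =
  elt n lamR (fun p m => c p m + c' p m) (fun i => g i + g' i).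
Proof.
apply/funext => x.
rewrite [LHS](_ : _ = elt n lamR c g x + elt n lamR c' g' x) // /elt /= addrACA.
congr (_ + _).
  rewrite -[bern_comb v c' _]mul1r -bern_combD.
  by apply: eq_bigr => p _; apply: eq_bigr => m _; rewrite mul1r.
by rewrite -big_split; apply: eq_bigr => i _; rewrite mulrDl.
Qed.

(** The sum of the three forms [wform] is six times the bubble, so the bubble,
the only cubic monomial missing from the vertex spaces, is supplied by [W^1]. *)
Lemma bubble_wext (R : realType) (v n : 'I_3 -> 'rV[R]_2) lamR x :
  nondegenerate_tri v -> (forall i, unit_normal v i (n i)) ->
  (forall i, refined_hat v i (lamR i)) -> tri v x ->
  bary v 0 x * bary v 1 x * bary v (- 1) x =
  \sum_i (2 / 3 * cnormal v n i) * wext v n lamR i x.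
Proof.
move=> v0 un hat vx; have [j jx] := exists_lowest v x.
have := sum_wform j (bary v ^~ x).
have -> : \sum_i wform i j (bary v ^~ x) =
    6 * \sum_i (2 / 3 * cnormal v n i) * wext v n lamR i x.
  rewrite mulr_sumr; apply: eq_bigr => i _; rewrite (wext_lowest i v0 un hat vx jx).
  by field; exact: cnormal_neq0.
by move/(mulfI _) => -> //; rewrite pnatr_eq0.
Qed.

Lemma U3P (R : realType) (v n : 'I_3 -> 'rV[R]_2) lamR f :
  nondegenerate_tri v -> (forall i, unit_normal v i (n i)) ->
  (forall i, refined_hat v i (lamR i)) ->
  U3 v n lamR f <-> exists c g, f = elt n lamR c g.
Proof.
move=> v0 un hat; split=> [[u [c ->] [w /W1P[g ->] <-]]|[c [g ->]]].
  have [d [e h]] := polyfun_cubic_form c v0.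
  have -> : sigL (tri v) (polyfun 3 c) =
      elt n lamR d (fun i => e * (2 / 3 * cnormal v n i)).
    apply: eq_sigL => x vx; rewrite h (bubble_wext v0 un hat vx) mulr_sumr.
    by congr (_ + _); apply: eq_bigr => i _; rewrite mulrA.
  by rewrite eltD; do 2 eexists.
have [d e] := polyfun_bern_comb v c.
exists (sigL (tri v) (polyfun 3 d)); first by exists d.
exists (elt n lamR (fun _ _ => 0) g); first by apply/W1P; exists g.
have -> : sigL (tri v) (polyfun 3 d) = elt n lamR c (fun=> 0).
  apply: eq_sigL => x _; rewrite -e [X in _ + X]big1 ?addr0 // => i _.
  by rewrite mul0r.
rewrite eltD; congr (elt n lamR _ _).
  by apply/funext => p; apply/funext => m; rewrite addr0.
by apply/funext => i; rewrite add0r.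
Qed.

(** Lets a basis be indexed by a structured finite type in place of [0..n-1]. *)
Lemma has_dim_family (R : realType) (V : lmodType R) (I : finType) (B : I -> V)
    (U : set V) :
  (forall c : I -> R, \sum_i c i *: B i = 0 -> forall i, c i = 0) ->
  (forall u, U u <-> exists c : I -> R, u = \sum_i c i *: B i) ->
  has_dim #|I| U.
Proof.
move=> indep span.
pose s := [seq B i | i <- enum I].
have size_s : size s = #|I| by rewrite size_map cardE.
pose h (k : 'I_(size s)) : I := enum_val (cast_ord size_s k).
pose h' (i : I) : 'I_(size s) := cast_ord (esym size_s) (enum_rank i).
have hK : cancel h h' by move=> k; rewrite /h /h' enum_valK cast_ordK.
have h'K : cancel h' h by move=> i; rewrite /h /h' cast_ordKV enum_rankK.
have E (c : 'I_(size s) -> R) :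
    \sum_(k < size s) c k *: s`_k = \sum_i c (h' i) *: B i.
  rewrite (reindex h'); last by exists h => ? _; [exact: h'K|exact: hK].
  apply: eq_bigr => i _; congr (_ *: _).
  by rewrite /h' /= (nth_map i) -?cardE ?ltn_ord // nth_enum_rank.
exists s; split=> //.
  by move=> c; rewrite E => /indep c0 k; rewrite -(hK k).
apply/seteqP; split=> u.
  by case=> c ->; apply/span; rewrite E; eexists.
case/span => c ->; exists (c \o h); rewrite E; apply: eq_bigr => i _ /=.
by rewrite h'K.
Qed.

(** * Gradients *)

Definition gbern (R : realType) (v : 'I_3 -> 'rV[R]_2) (p m : 'I_3)
    (x : 'rV[R]_2) : 'rV[R]_2 :=
  (2 * bary v p x * bary v m x) *: gradbary v p + bary v p x ^+ 2 *: gradbary v m.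

Lemma smooth_bern (R : realType) (v : 'I_3 -> 'rV[R]_2) p m :
  smooth (bern v p m) (gbern v p m).
Proof.
have s k := smooth_bary v k.
apply: eq_smooth (smoothM (smoothM (s p) (s p)) (s m)) => x; first by rewrite /bern expr2.
rewrite /gbern; move: (gradbary v p) (gradbary v m) (bary v p x) (bary v m x).
by move=> P M a b; apply/rowP => k; rewrite !mxE; ring.
Qed.

(** Agrees with [elt] on [T_j], but is smooth on the whole plane. *)
Definition piece (R : realType) (v n : 'I_3 -> 'rV[R]_2) c (g : 'I_3 -> R)
    (j : 'I_3) (x : 'rV[R]_2) : R :=
  bern_comb v c x
  + \sum_i (g i / (4 * cnormal v n i)) * wform i j (bary v ^~ x).

Definition gpiece (R : realType) (v n : 'I_3 -> 'rV[R]_2) (c : 'I_3 -> 'I_3 -> R)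
    (g : 'I_3 -> R) (j : 'I_3) (x : 'rV[R]_2) : 'rV[R]_2 :=
  \sum_p \sum_m c p m *: gbern v p m x
  + \sum_i (g i / (4 * cnormal v n i)) *: wgrad v i j (bary v ^~ x).

Lemma smooth_piece (R : realType) (v n : 'I_3 -> 'rV[R]_2) c g j :
  smooth (piece v n c g j) (gpiece v n c g j).
Proof.
apply: smoothD; apply: smooth_sum => i; last exact/smoothZ/smooth_wform.
by apply: smooth_sum => m; exact/smoothZ/smooth_bern.
Qed.

Lemma gpiece_tie (R : realType) (v n : 'I_3 -> 'rV[R]_2) c g j k x :
  lowest v j x -> lowest v k x -> gpiece v n c g j x = gpiece v n c g k x.
Proof.
move=> jx kx; rewrite /gpiece.
have e : bary v j x = bary v k x := lowest_tie jx kx.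
have w i : wgrad v i j (bary v ^~ x) = wgrad v i k (bary v ^~ x).
  exact: wgrad_tie e.
by under [X in _ + X = _]eq_bigr do rewrite w.
Qed.

Lemma ext_sigL (R : realType) (A : set 'rV[R]_2) (f : 'rV[R]_2 -> R) x :
  A x -> ext (sigL A f : A -> R^o) x = f x.
Proof.
move=> Ax; have := congr1 (fun h => h f x) (@sigLK _ _ (0 : R^o) A).
by rewrite /ext /= => ->; rewrite /patch mem_set.
Qed.

Lemma ext_elt (R : realType) (v n : 'I_3 -> 'rV[R]_2) lamR c g j x :
  nondegenerate_tri v -> (forall i, unit_normal v i (n i)) ->
  (forall i, refined_hat v i (lamR i)) -> tri v x -> lowest v j x ->
  ext (elt n lamR c g : tri v -> R^o) x = piece v n c g j x.
Proof.
move=> v0 un hat vx jx; rewrite ext_sigL // /piece; congr (_ + _).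
by apply: eq_bigr => i _; rewrite (wext_lowest i v0 un hat vx jx) mulrA mulrAC.
Qed.

Lemma elt_grad (R : realType) (v n : 'I_3 -> 'rV[R]_2) lamR c g :
  nondegenerate_tri v -> (forall i, unit_normal v i (n i)) ->
  (forall i, refined_hat v i (lamR i)) ->
  C1 (tri v) (ext (elt n lamR c g : tri v -> R^o)) /\
  forall j x, tri v x -> lowest v j x ->
    gradT (elt n lamR c g : tri v -> R^o) x = gpiece v n c g j x.
Proof.
move=> v0 un hat.
have [H [HG Hc HE]] := glue_lowest (smooth_piece v n c g)
  (fun j x => @ext_elt _ v n lamR c g j x v0 un hat) (@gpiece_tie _ v n c g).
have gE x : tri v x -> grad (tri v) (ext (elt n lamR c g : tri v -> R^o)) x = H x.
  by move=> vx; apply: grad_tri => //; exact: HG.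
split; last by move=> j x vx jx; rewrite /gradT gE //; exact: HE.
split; first by move=> x vx; rewrite gE //; exact: HG.
apply/subspace_continuousP => x vx; rewrite /from_subspace gE //.
have /subspace_continuousP/(_ x vx) := Hc; rewrite /from_subspace.
apply: cvg_trans; apply: near_eq_cvg.
by rewrite near_withinE; near=> y => vy; rewrite gE.
Unshelve. all: by end_near. Qed.

(** * Unisolvence *)

Lemma lowest_zero (R : realType) (v : 'I_3 -> 'rV[R]_2) j x :
  nondegenerate_tri v -> tri v x -> bary v j x = 0 -> lowest v j x.
Proof. by move=> v0 /(triP _ v0) h e k; rewrite e. Qed.

(** At [v_i] the other two coordinates both vanish; the piece [T_(i+1)] is chosen
to compute there. *)
Lemma lowest_vertex (R : realType) (v : 'I_3 -> 'rV[R]_2) i :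
  nondegenerate_tri v -> lowest v (i + 1) (v i).
Proof.
move=> v0; apply: lowest_zero => //; first exact: tri_vertex.
by rewrite bary_vertex // (negbTE (I3_neqD1 i)).
Qed.

Lemma bary_vertex_next (R : realType) (v : 'I_3 -> 'rV[R]_2) i :
  nondegenerate_tri v ->
  bary v (i + 1) (v i) = 0 /\ bary v (i + 1 + 1) (v i) = 0.
Proof.
move=> v0; rewrite I3D1 !bary_vertex //.
by rewrite (negbTE (I3_neqD1 i)) (negbTE (I3_neqB1 i)).
Qed.

Lemma elt_vertex (R : realType) (v n : 'I_3 -> 'rV[R]_2) lamR c g i :
  nondegenerate_tri v -> (forall i, unit_normal v i (n i)) ->
  (forall i, refined_hat v i (lamR i)) ->
  ext (elt n lamR c g : tri v -> R^o) (v i) = c i i.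
Proof.
move=> v0 un hat.
rewrite (ext_elt c g v0 un hat (tri_vertex i v0) (lowest_vertex i v0)) /piece.
have [z1 z2] := bary_vertex_next i v0.
rewrite [X in _ + X]big1 ?addr0 => [|k _]; last by rewrite wform_vertex ?mulr0.
rewrite /bern_comb /bern (eq_bigr (fun p => c p i * (i == p)%:R)) ?sum_delta // => p _.
rewrite (eq_bigr (fun m => c p m * (p == i)%:R ^+ 2 * (i == m)%:R)).
  by rewrite sum_delta eq_sym; case: eqP => _; rewrite ?expr1n ?expr0n ?mulr0 ?mulr1.
by move=> m _; rewrite !bary_vertex // (eq_sym m) mulrA.
Qed.

(** The extra functions drop out, because by [wgrad_edge] their gradients carry
a bubble factor that vanishes at the ends of an edge. For [k != i] the value is
[c i k - 3 c i i], so gradients recover the off-diagonal coefficients once the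
vertex values have given the diagonal ones. *)
Lemma gradT_vertex (R : realType) (v n : 'I_3 -> 'rV[R]_2) lamR c g i k :
  nondegenerate_tri v -> (forall i, unit_normal v i (n i)) ->
  (forall i, refined_hat v i (lamR i)) ->
  dot (gradT (elt n lamR c g : tri v -> R^o) (v i)) (v k - v i) =
  c i k + (2 * (i == k)%:R - 3) * c i i.
Proof.
move=> v0 un hat; have [_ gE] := elt_grad c g v0 un hat.
rewrite (gE _ _ (tri_vertex i v0) (lowest_vertex i v0)) /gpiece dotDl.
have [z1 z2] := bary_vertex_next i v0.
rewrite [X in _ + dot X _]big1 => [|m _]; last first.
  by rewrite wgrad_edge //= z2 mul0r mulr0 scale0r scaler0.
rewrite [dot 0 _]dotE !mxE !mul0r !addr0 dot_suml.
rewrite (eq_bigr (fun p => (c p k + (2 * (p == k)%:R - 3) * c p i) * (i == p)%:R)).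
  by rewrite sum_delta.
move=> p _; rewrite dot_suml.
rewrite (eq_bigr (fun m => (2 * (p == i)%:R * ((p == k)%:R - (p == i)%:R) * c p m)
  * (i == m)%:R + (p == i)%:R ^+ 2 * (c p m * (k == m)%:R - c p m * (i == m)%:R))).
  rewrite big_split /= sum_delta -mulr_sumr sumrB !sum_delta eq_sym.
  by case: eqP => _ /=; ring.
move=> m _; rewrite dotZl /gbern dotDl !dotZl !baryB !(bary_vertex _ _ v0).
rewrite (eq_sym k m) (eq_sym i m).
move: ((p == i)%:R : R) ((p == k)%:R : R) ((m == i)%:R : R) ((m == k)%:R : R).
by move=> *; ring.
Qed.

Lemma segptE (R : realType) (v : 'I_3 -> 'rV[R]_2) i p q (t : R) :
  bary v i (segpt (v p) (v q) t) =
  (1 - t) * bary v i (v p) + t * bary v i (v q).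
Proof.
have [a [b e]] := bary_affine v i.
by rewrite !e /segpt dotDr !dotZr; ring.
Qed.

Lemma bary_segpt (R : realType) (v : 'I_3 -> 'rV[R]_2) i (t : R) :
  nondegenerate_tri v -> let x := segpt (v (i + 1)) (v (i - 1)) t in
  [/\ bary v i x = 0, bary v (i + 1) x = 1 - t & bary v (i - 1) x = t].
Proof.
move=> v0 /=; have := I3_neqD1B1 i; have := I3_neqB1 i; have := I3_neqD1 i.
move: (i + 1) (i - 1) => p q pi qi pq.
rewrite !segptE !bary_vertex // !eqxx (eq_sym i p) (eq_sym i q) (eq_sym p q).
rewrite (negbTE pi) (negbTE qi) (negbTE pq) /=.
by rewrite !mulr0 !mulr1 !addr0 !add0r.
Qed.

Lemma tri_segpt (R : realType) (v : 'I_3 -> 'rV[R]_2) i (t : R) :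
  nondegenerate_tri v -> 0 <= t <= 1 -> tri v (segpt (v (i + 1)) (v (i - 1)) t).
Proof.
move=> v0 /andP[t0 t1]; apply/triP => // k.
by rewrite segptE !bary_vertex // addr_ge0 // mulr_ge0 // ?ler0n ?subr_ge0.
Qed.

(** The contributions of the cubic monomials cancel, and [wgrad_edge] evaluates
what is left; the factor [3 * d i] is the excess of 4 over 1. *)
Lemma gpiece_edge (R : realType) (v n : 'I_3 -> 'rV[R]_2) c g g' i (t : R) :
  nondegenerate_tri v ->
  let x := segpt (v (i + 1)) (v (i - 1)) t in
  let d k := (g k - g' k) / (4 * cnormal v n k) in
  dot (gpiece v n c g i x) (n i) = dot (gpiece v n c g' i x) (n i)
   + (\sum_k d k + 3 * d i) * cnormal v n i * (t * (1 - t)).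
Proof.
move=> v0 x d; have [xi xp xq] := bary_segpt i t v0.
rewrite /gpiece !dotDl -addrA; congr (_ + _).
apply/eqP; rewrite addrC -subr_eq -dotBl -sumrB dot_suml; apply/eqP.
rewrite (eq_bigr (fun k => d k * (cnormal v n i * (t * (1 - t)))
   + 3 * cnormal v n i * (t * (1 - t)) * d k * (i == k)%:R)); last first.
  move=> k _; rewrite !wgrad_edge // -scalerBl !dotZl -/(cnormal v n i).
  rewrite xp xq (eq_sym i k) /d ![(g k - g' k) / _]mulrBl.
  move: (g k / _) (g' k / _) (cnormal v n i) ((k == i)%:R : R) => *; ring.
by rewrite big_split /= sum_delta -mulr_suml; ring.
Qed.

Lemma gpiece_edge_continuous (R : realType) (v n : 'I_3 -> 'rV[R]_2) c g i :
  continuous (fun t : R =>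
    dot (gpiece v n c g i (segpt (v (i + 1)) (v (i - 1)) t)) (n i)).
Proof.
have [_ cG] := smooth_piece v n c g i.
pose G s := gpiece v n c g i (segpt (v (i + 1)) (v (i - 1)) s).
rewrite (_ : (fun t => _) = fun s => G s 0 0 * n i 0 0 + G s 0 1 * n i 0 1).
  move=> t.
  have seg_cont : segpt (v (i + 1)) (v (i - 1)) s @[s --> t] -->
      segpt (v (i + 1)) (v (i - 1)) t.
    rewrite /segpt; apply: cvgD; apply: cvgZr_tmp; last exact: cvg_id.
    by apply: cvgB; [exact: cvg_cst|exact: cvg_id].
  have coord k : (fun s : R => G s 0 k) @ t --> G t 0 k.
    exact: (continuous_comp (continuous_comp seg_cont (cG _))
      (@coord_continuous R 1 2 0 k _)).
  by apply: cvgD; (apply: cvgM; [exact: coord|exact: cvg_cst]).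
by apply/funext => s; exact: dotE.
Qed.

(** This is the value [B(2,2)] of the beta function. *)
Lemma integral_bubble (R : realType) :
  \int[@lebesgue_measure R]_(t in `[0%R, 1%R]) (t * (1 - t)) = 6^-1 :> R.
Proof.
transitivity (@beta_fun R 2 2).
  rewrite /beta_fun -Rintegral_mkcond.
  by apply: eq_Rintegral => t _; rewrite /XMonemX /= !expr1.
by rewrite (beta_funSSnSm 0 1) beta_fun1Sn; field.
Qed.

Lemma Rintegral_add_bubble (R : realType) (f : R -> R) (k : R) : continuous f ->
  \int[@lebesgue_measure R]_(t in `[0%R, 1%R]) (f t + k * (t * (1 - t))) =
  \int[@lebesgue_measure R]_(t in `[0%R, 1%R]) f t + k / 6.
Proof.
move=> cf.
have int (h : R -> R) : continuous h ->
    (@lebesgue_measure R).-integrable `[0%R, 1%R] (EFin \o h).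
  move=> ch; apply: continuous_compact_integrable; first exact: segment_compact.
  exact: continuous_subspaceT.
have cb : continuous (fun t : R => t * (1 - t)).
  move=> t; apply: cvgM; first exact: cvg_id.
  by apply: cvgB; [exact: cvg_cst|exact: cvg_id].
have ckb : continuous (fun t : R => k * (t * (1 - t))).
  by move=> t; apply: cvgM; [exact: cvg_cst|exact: cb].
rewrite RintegralD //; [|exact: int|exact: int].
by rewrite RintegralZl ?integral_bubble //; exact: int.
Qed.

Lemma edge_dof_elt (R : realType) (v n : 'I_3 -> 'rV[R]_2) lamR c g i :
  nondegenerate_tri v -> (forall i, unit_normal v i (n i)) ->
  (forall i, refined_hat v i (lamR i)) ->
  edge_dof n (i := i) (sigL (edge v i) (fun=> 1)) (elt n lamR c g) =
  enorm (v (i - 1) - v (i + 1)) * \int[@lebesgue_measure R]_(t in `[0%R, 1%R])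
    dot (gpiece v n c g i (segpt (v (i + 1)) (v (i - 1)) t)) (n i).
Proof.
move=> v0 un hat; congr (_ * _); apply: eq_Rintegral => t /set_mem t01.
have [z _ _] := bary_segpt i t v0.
have vx := tri_segpt i v0 t01.
rewrite ((elt_grad c g v0 un hat).2 i) //; last exact: lowest_zero.
by rewrite ext_sigL ?mulr1 //; exists t.
Qed.

(** Equal values and gradients at the vertices give equal coefficients of the
cubic monomials. The edge moments then differ by the matrix with diagonal
entries 4 and off-diagonal entries 1 applied to the scaled coefficient
differences of the extra functions, and this matrix is invertible. *)
Lemma unisolvence (R : realType) (v n : 'I_3 -> 'rV[R]_2) lamR c g c' g' :
  nondegenerate_tri v -> (forall i, unit_normal v i (n i)) ->
  (forall i, refined_hat v i (lamR i)) ->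
  same_dofs n (elt n lamR c g : tri v -> R^o) (elt n lamR c' g') ->
  c = c' /\ g = g'.
Proof.
move=> v0 un hat [val grd edg].
have cd i : c i i = c' i i.
  by have := val i; rewrite !elt_vertex.
have cc' : c = c'.
  apply/funext => i; apply/funext => k.
  have := congr1 (fun w => dot w (v k - v i)) (grd i).
  by rewrite /= !gradT_vertex // cd => /addIr.
split=> //; rewrite -{}cc' in edg.
pose d k := (g k - g' k) / (4 * cnormal v n k).
have d0 i : \sum_k d k + 3 * d i = 0.
  have q0 : Defs.Poly 0 (edge v i) (sigL (edge v i) (fun=> 1)).
    exists (fun _ _ => 1); apply: eq_sigL => x _.
    by rewrite /polyfun big_ord1 big_mkcond big_ord1 /= !expr0 !mulr1.
  have E : \int[@lebesgue_measure R]_(t in `[0%R, 1%R])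
      dot (gpiece v n c g i (segpt (v (i + 1)) (v (i - 1)) t)) (n i) =
    \int[@lebesgue_measure R]_(t in `[0%R, 1%R])
      dot (gpiece v n c g' i (segpt (v (i + 1)) (v (i - 1)) t)) (n i)
    + (\sum_k d k + 3 * d i) * cnormal v n i / 6.
    rewrite -(Rintegral_add_bubble _ (@gpiece_edge_continuous _ v n c g' i)).
    by apply: eq_Rintegral => t _; exact: gpiece_edge.
  have := edg i _ q0.
  rewrite (edge_dof_elt c g i v0 un hat) (edge_dof_elt c g' i v0 un hat) E.
  move/(mulfI (lt0r_neq0 (enorm_gt0 (edge_neq0 i v0)))).
  move/(canRL (addKr _)); rewrite addNr => /eqP.
  rewrite !mulf_eq0 (negbTE (cnormal_neq0 v0 (un i))) invr_eq0 pnatr_eq0.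
  by rewrite !orbF => /eqP.
(* Summing the three equations gives six times the total. *)
have s0 : \sum_k d k = 0.
  by have := d0 0; have := d0 1; have := d0 (- 1); rewrite sum_I3; lra.
apply/funext => i; apply/eqP; rewrite -subr_eq0.
have /eqP : d i = 0 by have := d0 i; rewrite s0; lra.
rewrite /d mulf_eq0 invr_eq0 mulf_eq0 (negbTE (cnormal_neq0 v0 (un i))).
by rewrite pnatr_eq0 !orbF.
Qed.

Lemma elt0 (R : realType) (v n : 'I_3 -> 'rV[R]_2) lamR :
  elt n lamR (fun _ _ => 0) (fun=> 0) = (0 : tri v -> R^o).
Proof.
apply/funext => x; rewrite /elt /= /bern_comb [X in X + _]big1 => [|p _].
  by rewrite add0r big1 // => i _; rewrite mul0r.
by rewrite big1 // => m _; rewrite mul0r.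
Qed.

Lemma elt_eq0 (R : realType) (v n : 'I_3 -> 'rV[R]_2) lamR c g :
  nondegenerate_tri v -> (forall i, unit_normal v i (n i)) ->
  (forall i, refined_hat v i (lamR i)) ->
  elt n lamR c g = (0 : tri v -> R^o) ->
  (forall p m, c p m = 0) /\ forall i, g i = 0.
Proof.
move=> v0 un hat e.
have sd : same_dofs n (elt n lamR c g : tri v -> R^o)
    (elt n lamR (fun _ _ => 0) (fun=> 0)).
  by rewrite e elt0.
by have [-> ->] := unisolvence v0 un hat sd.
Qed.

(** * Direct sum and dimension *)

Lemma sum_basis_elt (R : realType) (v n : 'I_3 -> 'rV[R]_2) lamR
    (c : 'I_3 * 'I_3 + 'I_3 -> R) :
  \sum_s c s *: match s with
    | inl pm => (sigL (tri v) (bern v pm.1 pm.2) : tri v -> R^o)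
    | inr i => wfun v n lamR i
    end = elt n lamR (fun p m => c (inl (p, m))) (fun i => c (inr i)).
Proof.
apply/funext => x; rewrite fct_sumE big_sumType /elt /= /bern_comb pair_bigA /=.
by congr (_ + _); apply: eq_bigr => -[p m] _.
Qed.

Theorem corollary3p5 (R : realType) (v n : 'I_3 -> 'rV[R]_2)
    (lamR : 'I_3 -> 'rV[R]_2 -> R)
    (v_nondegenerate : nondegenerate_tri v)
    (n_normal : forall i, unit_normal v i (n i))
    (lamR_hat : forall i, refined_hat v i (lamR i)) :
  [/\ [/\ U3 v n lamR =
            sum2 (sumI (fun i => sum2 (Uv0 v i) (Uv1 v i))) (W1 v n lamR),
          forall i, direct2 (Uv0 v i) (Uv1 v i),
          directI (fun i => sum2 (Uv0 v i) (Uv1 v i))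
        & direct2 (sumI (fun i => sum2 (Uv0 v i) (Uv1 v i))) (W1 v n lamR)],
      has_dim 12 (U3 v n lamR),
      forall f, U3 v n lamR f -> C1 (tri v) (ext f)
    & forall f g, U3 v n lamR f -> U3 v n lamR g -> same_dofs n f g -> f = g].
Proof.
have UP f := U3P f v_nondegenerate n_normal lamR_hat.
have inj c g := @elt_eq0 _ v n lamR c g v_nondegenerate n_normal lamR_hat.
have splitE c g : elt n lamR c (fun=> 0) + elt n lamR (fun _ _ => 0) g
    = (elt n lamR c g : tri v -> R^o).
  rewrite eltD; congr (elt n lamR _ _).
    by apply/funext => p; apply/funext => m; rewrite addr0.
  by apply/funext => i; rewrite add0r.
have dirI : directI (fun i => sum2 (Uv0 v i) (Uv1 v i)).
  move=> u hu s0 i.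
  have [c hc] := choice (fun j => (vertex_spaceP j (u j)).1 (hu j)).
  have [c0 _] : (forall p m, c p m = 0) /\ forall j : 'I_3, (0 : R) = 0.
    apply: inj; rewrite -sum_vertex_elt; transitivity (\sum_j u j); last exact: s0.
    by apply: eq_bigr => j _; rewrite hc.
  rewrite hc; apply/funext => x; rewrite /= big1 // => m _.
  by rewrite c0 mul0r.
split.
- split=> //.
  + apply/seteqP; split=> f.
      case/UP => c [g ->].
      exists (elt n lamR c (fun=> 0)).
        by apply/(sum_vertex_spacesP n lamR); exists c.
      by exists (elt n lamR (fun _ _ => 0) g); [apply/W1P; exists g|].
    case=> _ /(sum_vertex_spacesP n lamR)[c ->] [_ /W1P[g ->] <-].
    by apply/UP; exists c, g.
  + move=> i _ _ /lspan1P[k ->] /lspan2P[l [m ->]].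
    have [e1 e2 e3] := I3_caseE i k l m.
    have := vertex_spaceE v i (I3_case i k l m); rewrite e1 e2 e3 => <-.
    pose c p := if p == i then I3_case i k l m else fun=> 0.
    have -> : sigL (tri v) (fun x => \sum_q I3_case i k l m q * bern v i q x)
        = elt n lamR c (fun=> 0).
      rewrite -sum_vertex_elt (bigD1 i) //= big1 ?addr0 /c ?eqxx // => p pi.
      apply/funext => x /=; rewrite (negbTE pi) big1 // => q _.
      by rewrite mul0r.
    move=> /inj[c0 _].
    have z q : I3_case i k l m q = 0 by have := c0 i q; rewrite /c eqxx.
    have := z i; have := z (i + 1); have := z (i - 1).
    by rewrite e1 e2 e3 => -> -> ->; rewrite !scale0r addr0.
  + move=> _ _ /(sum_vertex_spacesP n lamR)[c ->] /W1P[g ->].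
    rewrite splitE => /inj[c0 g0].
    rewrite (_ : c = fun _ _ => 0); last by apply/funext => p; apply/funext.
    by rewrite (_ : g = fun=> 0); [rewrite elt0|exact/funext].
- rewrite (_ : 12%N = #|{: 'I_3 * 'I_3 + 'I_3}|); last first.
    by rewrite card_sum card_prod card_ord.
  apply: (@has_dim_family _ _ _ (fun s => match s with
    | inl pm => (sigL (tri v) (bern v pm.1 pm.2) : tri v -> R^o)
    | inr i => wfun v n lamR i
    end)) => [c|f].
    by rewrite sum_basis_elt => /inj[c0 g0] [[p m]|i]; [exact: c0|exact: g0].
  split=> [/UP[c [g ->]]|[c ->]]; last by apply/UP; rewrite sum_basis_elt; do 2 eexists.
  exists (fun s => match s with inl pm => c pm.1 pm.2 | inr i => g i end).
  by rewrite sum_basis_elt.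
- move=> f /UP[c [g ->]].
  exact: (elt_grad c g v_nondegenerate n_normal lamR_hat).1.
- move=> f f' /UP[c [g ->]] /UP[c' [g' ->]].
  by move=> /(unisolvence v_nondegenerate n_normal lamR_hat)[-> ->].
Qed.
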